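(* Let $G=(V,E)$ be a finite simple graph. Then $$\sqrt{s^{+}(G)}\;\leq\;\sum_{v\in V}\left(1-\frac{1}{c(v)}\right).$$ Moreover, equality holds if and only if one of the following occurs: (i) $G$ is edgeless; (ii) for some integers $r\geq 2$, $t\geq 1$, and $q\geq 0$, $$G\cong K_{\underbrace{t,\ldots,t}_{r\text{ parts}}}\,\dot\cup\, qK_1 .$$
   Context: All graphs are finite and simple. For a graph $G=(V,E)$ of order $n$ with adjacency matrix $A(G)$, let $\lambda_1(G)\geq\cdots\geq\lambda_n(G)$ be the eigenvalues of $A(G)$ (with multiplicity). The positive square energy of $G$ is $s^{+}(G):=\sum_{i:\lambda_i(G)>0}\lambda_i(G)^2$. For $v\in V$, the local clique number $c(v)$ is the maximum order of a clique of $G$ containing $v$, i.e. $c(v)=\max\{|Q| : v\in Q\subseteq V,\ G[Q]\text{ is complete}\}$ (so $c(v)=1$ exactly when $v$ is isolated). For positive integers $s_1,\ldots,s_p$, $K_{s_1,\ldots,s_p}$ denotes the complete $p$-partite graph whose partite sets have orders $s_1,\ldots,s_p$. $qK_1$ denotes the graph consisting of $q$ isolated vertices, and $\dot\cup$ denotes disjoint union of graphs. *)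

(* Defs.v *)
From HB Require Import structures.
From mathcomp Require Import all_boot all_order all_algebra.
From mathcomp Require Import reals.
From mathcomp Require Import polyrcf complex.

Set Implicit Arguments.
Unset Strict Implicit.
Unset Printing Implicit Defensive.

Import Order.TTheory GRing.Theory Num.Theory.

Local Open Scope ring_scope.

Record sgraph := SGraph {
  vertex :> finType;
  adj : rel vertex;
  adj_sym : symmetric adj;
  adj_irrefl : irreflexive adj }.

Arguments adj {s} : rename.

Definition isomorphic (G H : sgraph) : Prop :=
  exists2 f : G -> H, bijective f & forall u v, adj (f u) (f v) = adj u v.

Definition edgeless (G : sgraph) : Prop := forall u v : G, ~~ adj u v.

Lemma no_edge_sym (T : Type) : symmetric (fun _ _ : T => false).
Proof. by []. Qed.

Lemma no_edge_irrefl (T : Type) : irreflexive (fun _ _ : T => false).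
Proof. by []. Qed.

Definition isolated_vertices (q : nat) : sgraph :=
  SGraph (@no_edge_sym 'I_q) (@no_edge_irrefl 'I_q).

Section CompleteMultipartite.
Variables (p : nat) (s : 'I_p -> nat).

Definition multipartite_adj : rel {i : 'I_p & 'I_(s i)} :=
  fun u v => tag u != tag v.

Lemma multipartite_sym : symmetric multipartite_adj.
Proof. by move=> u v; rewrite /multipartite_adj eq_sym. Qed.

Lemma multipartite_irrefl : irreflexive multipartite_adj.
Proof. by move=> u; rewrite /multipartite_adj eqxx. Qed.

(* K_{s_0, ..., s_(p-1)}: a vertex is a part i together with an element of
   'I_(s i). *)
Definition complete_multipartite : sgraph :=
  SGraph multipartite_sym multipartite_irrefl.

End CompleteMultipartite.

Section DisjointUnion.
Variables G H : sgraph.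

Definition disjoint_union_adj : rel (G + H)%type := fun u v =>
  match u, v with
  | inl x, inl y => adj x y
  | inr x, inr y => adj x y
  | _, _ => false
  end.

Lemma disjoint_union_sym : symmetric disjoint_union_adj.
Proof. by move=> [x|x] [y|y] //=; apply: adj_sym. Qed.

Lemma disjoint_union_irrefl : irreflexive disjoint_union_adj.
Proof. by move=> [x|x] /=; apply: adj_irrefl. Qed.

Definition disjoint_union : sgraph :=
  SGraph disjoint_union_sym disjoint_union_irrefl.

End DisjointUnion.

Definition clique (G : sgraph) (Q : {set G}) : bool :=
  [forall u in Q, forall v in Q, (u != v) ==> adj u v].

Definition local_clique_number (G : sgraph) (v : G) : nat :=
  \max_(Q : {set G} | (v \in Q) && clique Q) #|Q|.

Definition adjacency (R : realType) (G : sgraph) : 'M[R]_#|G| :=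
  \matrix_(i, j) (adj (enum_val i) (enum_val j))%:R.

(* The real roots of the characteristic polynomial in nonincreasing order,
   each repeated according to its algebraic multiplicity. *)
Definition eigenvalues (R : realType) (n : nat) (A : 'M[R]_n) : seq R :=
  flatten [seq nseq (mup x (char_poly A)) x | x <- rev (rootsR (char_poly A))].

Definition positive_square_energy (R : realType) (G : sgraph) : R :=
  \sum_(x <- eigenvalues (adjacency R G) | 0 < x) x ^+ 2.

(* For a symmetric matrix the above are all the eigenvalues. *)
Lemma char_poly_eigenvalues (R : realType) (n : nat) (A : 'M[R]_n) :
  A^T = A -> char_poly A = \prod_(x <- eigenvalues A) ('X - x%:P).
Proof.
move=> symA; pose c := real_complex R.
pose B := map_mx c A.
have hermB : B \is hermsymmx.
  apply/is_hermitianmxP; rewrite expr0 scale1r.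
  by apply/matrixP=> i j; rewrite !mxE -{1}symA mxE /c conj_Creal ?complex_real.
have cB : char_poly B = \prod_(i < n) ('X - (spectral_diag B 0 i)%:P).
  have /orthomx_spectralP E := hermitian_normalmx hermB.
  set P := spectralmx B in E; have uP : P \in unitmx by apply: spectral_unit.
  set D := spectral_diag B in E *.
  have -> : char_poly B = char_poly (diag_mx D).
    rewrite /char_poly {1}/char_poly_mx E.
    have -> : 'X%:M = map_mx polyC (invmx P) *m 'X%:M *m map_mx polyC P.
      by rewrite scalar_mxC -mulmxA -map_mxM mulVmx // map_mx1 mulmx1.
    rewrite !map_mxM -mulmxBl -mulmxBr !det_mulmx mulrAC -det_mulmx.
    by rewrite -map_mxM mulVmx // map_mx1 det1 mul1r.
  rewrite char_poly_trig ?diag_mx_is_trig //.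
  by apply: eq_bigr => i _; rewrite mxE eqxx mulr1n.
have realB i : spectral_diag B 0 i = c (complex.Re (spectral_diag B 0 i)).
  have /mxOverP /(_ 0 i) h := hermitian_spectral_diag_real hermB.
  by rewrite /c RRe_real.
pose s := [seq complex.Re (spectral_diag B 0 i) | i <- enum 'I_n].
have cA : char_poly A = \prod_(x <- s) ('X - x%:P).
  apply: (map_poly_inj c); rewrite map_char_poly -/B cB rmorph_prod big_map.
  rewrite big_enum /=; apply: eq_bigr => i _.
  by rewrite map_polyXsubC {1}realB.
have p0 : char_poly A != 0 by rewrite monic_neq0 ?char_poly_monic.
rewrite {1}cA; apply: perm_big; apply/allP => x _ /=.
rewrite /eigenvalues -{1}(mu_prod_XsubC x s) -cA.
set p := char_poly A in p0 *.
have countE (r : seq R) : uniq r ->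
    count_mem x (flatten [seq nseq (mup y p) y | y <- r])
    = if x \in r then mup x p else 0%N.
  elim: r => //= y r IH /andP[yr ur].
  rewrite count_cat count_nseq IH // in_cons /= [y == x]eq_sym.
  by have [->|_] := eqVneq x y; rewrite ?(negPf yr) ?mul1n ?addn0.
rewrite countE ?rev_uniq ?uniq_roots // mem_rev.
rewrite -(roots_on_rootsR p0 x) in_itv /=.
by have [//|/mupNroot ->] := boolP (root p x).
Qed.

(* Main.v *)
From mathcomp Require Import boolp classical_sets topology normedtype derive.
Require Import Defs.
From mathcomp Require Import all_boot all_order all_algebra.
From mathcomp Require Import reals complex ring lra zify.
Import numFieldNormedType.Exports.

Set Implicit Arguments.
Unset Strict Implicit.
Unset Printing Implicit Defensive.

Import Order.TTheory GRing.Theory Num.Theory.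

Local Open Scope ring_scope.

(** Write c(v) for the local clique number, k(v) = 1 - 1/c(v), and let A be the
    adjacency matrix with positive part A+.  The number sqrt(s+) is the value of
    <A, X> at X = A+ / |A+|, a positive semidefinite matrix of Frobenius norm 1
    ([energy_gram]).  So the bound is the case a = 1 of the inequality
      sum over adjacent u, v of X_uv a_u a_v  <=  |X| * sum_v k(v) a_v^2,
    valid for every Gram matrix X and every real vector a ([edge_form_le]).

    This inequality is proved at a maximum of its left side on |X| = 1,
    sum_v k(v) a_v^2 = 1, for an induced subgraph U with its own local clique
    numbers.  Induction on |U| allows a_v <> 0 on U and no isolated vertex in U.
    Put w_v = a_v^2 and Y_uv = X_uv^2.  Varying a_v and rescaling the v-th Gram
    vector shows that Y has row sums m_v = k(v) w_v, of total 1
    ([stationary_of_maximum]).  If the maximum s is at least 1, Cauchy-Schwarz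
    on the row of v bounds from below the mass that Y places on edges at v, hence
      (mass of Y on non-neighbours of v)  <=  m_v (1 - k(v) / d_v),
    where d_v is the weight of the neighbours of v.  As Y is positive
    semidefinite with total mass 1, m(S)^2 is at most the mass of Y on S * S.
    When S is stable this is mass on non-edges, so
      m(S)  <=  max over x in S of (1 - k(x) / d_x).

    Take r the largest clique number and Q an r-clique maximizing the sum of the
    d_q.  For q in Q let the cell of q be the set of x whose neighbours in Q are
    exactly the rest of Q; replacing q by x gives another r-clique.  So cells are
    stable and pairwise disjoint, and d_x <= d_q on the cell of q.  When every
    local clique number is r, counting the edges between U and Q gives
      sum_q d_q  <=  (r - 2) w(U) + sum_q w(cell of q),
    while m(cell of q) <= 1 - k/d_q.  With k = 1 - 1/r and w = m/k these combine to
      sum_q (d_q + 1/d_q)  <=  2 r,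
    which holds only if every d_q is 1.  Vertices of smaller clique number
    disturb this count only when their clique number is r - 1 and they miss
    exactly two vertices of Q ([missing_count_le]); these pendant vertices are
    non-adjacent to the cells of the vertices they miss, so they can be put with
    a small coefficient into the test vector of those cells, which pays for them
    ([cell_pendant_le], [clique_vertex_slack]).

    Hence s <= 1, and s = 1 forces equality throughout: the cells cover U, have
    equal weight, and form a complete r-partite graph ([stationary_structure]).
    Equality in the theorem is the case where a = 1 is a maximum, so the cells
    then have the same cardinality.  Conversely t(r - 1) is an eigenvalue of
    the complete r-partite graph with parts of order t, and it equals the
    bound. *)

(** * Cliques and local clique numbers *)

Section Cliques.
Variable G : sgraph.
Implicit Types (U Q : {set G}) (u v x y q : G).

Lemma cliqueP Q : reflect {in Q &, forall u v, u != v -> adj u v} (clique Q).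
Proof.
apply: (iffP forall_inP) => [h u v uQ vQ uv|h u uQ].
  by have /forall_inP /(_ v vQ) /implyP := h u uQ; apply.
by apply/forall_inP => v vQ; apply/implyP; apply: h.
Qed.

Lemma cliqueS Q Q' : Q' \subset Q -> clique Q -> clique Q'.
Proof. by move=> /subsetP s /cliqueP h; apply/cliqueP => u v /s uQ /s; apply: h. Qed.

Lemma cliqueU1 Q x : clique Q -> {in Q, forall q, adj x q} -> clique (x |: Q).
Proof.
move=> /cliqueP h hx; apply/cliqueP => u v /setU1P[->|uQ] /setU1P[->|vQ].
- by rewrite eqxx.
- by move=> _; apply: hx.
- by move=> _; rewrite adj_sym; apply: hx.
- exact: h.
Qed.

Lemma cardU1_adj Q x : {in Q, forall q, adj x q} -> #|x |: Q| = #|Q|.+1.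
Proof.
move=> h; rewrite cardsU1; case: (boolP (x \in Q)) => // /h.
by rewrite adj_irrefl.
Qed.

Definition clique_number_in U v : nat :=
  \max_(Q : {set G} | [&& v \in Q, Q \subset U & clique Q]) #|Q|.

Lemma clique_number_in_setT v :
  clique_number_in [set: G] v = local_clique_number v.
Proof. by apply: eq_bigl => Q; rewrite subsetT. Qed.

Lemma leq_clique_number_in U Q v :
  v \in Q -> Q \subset U -> clique Q -> (#|Q| <= clique_number_in U v)%N.
Proof.
by move=> vQ QU cQ; apply: (@leq_bigmax_cond _ _ (fun Q : {set G} => #|Q|)); apply/and3P.
Qed.

Lemma clique1 v : clique [set v].
Proof. by apply/cliqueP => u u' /set1P-> /set1P->; rewrite eqxx. Qed.

Lemma clique_number_in_attained U v : v \in U ->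
  exists2 Q : {set G}, [/\ v \in Q, Q \subset U & clique Q] &
    #|Q| = clique_number_in U v.
Proof.
move=> vU.
pose P Q := [&& v \in Q, Q \subset U & clique Q].
have P0 : (0 < #|[pred Q | P Q]|)%N.
  by apply/card_gt0P; exists [set v]; rewrite !inE /P set11 sub1set vU clique1.
have [Q PQ e] := eq_bigmax_cond (fun Q : {set G} => #|Q|) P0.
move: PQ; rewrite inE => /and3P[h1 h2 h3].
by exists Q => //; rewrite -e; apply: eq_bigl.
Qed.

Lemma clique_number_in_mono U U' v :
  U' \subset U -> (clique_number_in U' v <= clique_number_in U v)%N.
Proof.
move=> s; apply/bigmax_leqP => Q /and3P[vQ QU cQ].
by apply: leq_clique_number_in => //; apply: subset_trans s.
Qed.

Lemma clique_number_in_gt0 U v : v \in U -> (0 < clique_number_in U v)%N.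
Proof.
move=> vU; apply: leq_trans (leq_clique_number_in (set11 v) _ (clique1 v)).
  by rewrite cards1.
by rewrite sub1set.
Qed.

Lemma clique_number_in_gt1 U u v : u \in U -> v \in U -> adj u v ->
  (1 < clique_number_in U u)%N.
Proof.
move=> uU vU uv.
have cuv : clique (u |: [set v]).
  by apply: cliqueU1 (clique1 v) _ => q /set1P->.
apply: leq_trans (leq_clique_number_in (setU11 _ _) _ cuv).
  by rewrite cardU1_adj ?cards1 // => q /set1P->.
by apply/subsetP => x /setU1P[->|/set1P->].
Qed.

Section MaximumClique.
Variables (U Q : {set G}).
Hypotheses (QU : Q \subset U) (cQ : clique Q).
Hypothesis Qmax : {in U, forall v, (clique_number_in U v <= #|Q|)%N}.

Definition neighbours x := [set q in Q | adj x q].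

(** For q in Q these are q itself and the vertices that can replace it in the
    clique. *)
Definition cell q := [set x in U | neighbours x == Q :\ q].

(** The only vertices outside the cells that can make the edge count around Q
    exceed its value for a complete multipartite graph. *)
Definition pendant q :=
  [set x in U | [&& (clique_number_in U x).+1 == #|Q|,
                    #|neighbours x|.+2 == #|Q| & ~~ adj x q]].

Lemma neighboursS x : neighbours x \subset Q.
Proof. by apply/subsetP => q; rewrite inE => /andP[]. Qed.

Lemma adj_neighbours x : {in neighbours x, forall q, adj x q}.
Proof. by move=> q; rewrite inE => /andP[]. Qed.

(** Adding x to its neighbours in Q gives a clique. *)
Lemma card_neighbours x : x \in U -> (#|neighbours x| < clique_number_in U x)%N.
Proof.
move=> xU; rewrite -(cardU1_adj (@adj_neighbours x)).
apply: leq_clique_number_in; first exact: setU11.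
  by rewrite subUset sub1set xU (subset_trans (neighboursS x)).
by apply: cliqueU1 (@adj_neighbours x); apply: cliqueS (neighboursS x) cQ.
Qed.

Lemma cellP q x : q \in Q -> x \in cell q ->
  [/\ x \in U, ~~ adj x q & {in Q :\ q, forall q', adj x q'}].
Proof.
rewrite inE => qQ /andP[xU /eqP e]; split=> //.
  have : q \notin neighbours x by rewrite e setD11.
  by rewrite inE qQ.
by move=> q'; rewrite -e; apply: adj_neighbours.
Qed.

Lemma mem_cell q : q \in Q -> q \in cell q.
Proof.
move=> qQ; rewrite inE (subsetP QU) //=; apply/eqP/setP => x; rewrite !inE.
have [->|xq] := eqVneq x q; first by rewrite adj_irrefl andbF.
case xQ: (x \in Q) => //=.
by rewrite (cliqueP _ cQ q x) // eq_sym.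
Qed.

Lemma cell_exchange q x : q \in Q -> x \in cell q ->
  [/\ x |: Q :\ q \subset U, clique (x |: Q :\ q) & #|x |: Q :\ q| = #|Q|].
Proof.
move=> qQ /(cellP qQ)[xU _ h]; split.
- by rewrite subUset sub1set xU (subset_trans _ QU) // subsetDl.
- by apply: cliqueU1 h; apply: cliqueS cQ; apply: subsetDl.
- by rewrite cardU1_adj // [in RHS](cardsD1 q) qQ.
Qed.

Lemma clique_number_in_cell q x : q \in Q -> x \in cell q ->
  clique_number_in U x = #|Q|.
Proof.
move=> qQ xc; have [s c e] := cell_exchange qQ xc.
have [xU _ _] := cellP qQ xc.
apply/eqP; rewrite eqn_leq Qmax //= -e.
by apply: leq_clique_number_in => //; apply: setU11.
Qed.

(** An edge inside a cell could replace q in Q by two vertices. *)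
Lemma cell_stable q x y : q \in Q -> x \in cell q -> y \in cell q -> ~~ adj x y.
Proof.
move=> qQ xc yc; apply/negP => xy.
have [yU _ hy] := cellP qQ yc; have [s c e] := cell_exchange qQ xc.
have hy' : {in x |: Q :\ q, forall z, adj y z}.
  by move=> z /setU1P[->|/hy //]; rewrite adj_sym.
have := Qmax yU; rewrite leqNgt => /negP[].
rewrite -e -(cardU1_adj hy'); apply: leq_clique_number_in.
- exact: setU11.
- by rewrite subUset sub1set yU.
- exact: cliqueU1.
Qed.

(** If y is pendant and misses q and q', an edge from y to the cell of q would
    complete Q minus {q, q'} to a clique of order #|Q| through y. *)
Lemma cell_pendant q x y : q \in Q -> x \in cell q -> y \in pendant q -> ~~ adj x y.
Proof.
move=> qQ xc; rewrite inE => /and4P[yU /eqP cy /eqP ny yq]; apply/negP => xy.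
have [xU _ hx] := cellP qQ xc.
have hx' : {in neighbours y, forall z, adj x z}.
  move=> z; rewrite inE => /andP[zQ yz]; apply: hx; rewrite !inE zQ andbT.
  by apply: contraNneq yq => <-.
have hy : {in x |: neighbours y, forall z, adj y z}.
  by move=> z /setU1P[->|/adj_neighbours //]; rewrite adj_sym.
have : (#|Q| <= clique_number_in U y)%N.
  rewrite -ny -(cardU1_adj hx') -(cardU1_adj hy).
  apply: leq_clique_number_in; first exact: setU11.
    by rewrite !subUset !sub1set yU xU (subset_trans (neighboursS y)).
  apply: cliqueU1 hy; apply: cliqueU1 hx'.
  exact: cliqueS (neighboursS y) cQ.
by rewrite -cy ltnn.
Qed.

Lemma card_cells x : x \in U ->
  #|[set q in Q | x \in cell q]| = (#|neighbours x|.+1 == #|Q|) :> nat.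
Proof.
move=> xU; have := neighboursS x; case: eqP => [e|ne] s.
  have /cards1P[q0 e0] : #|Q :\: neighbours x| == 1%N.
    by rewrite cardsD (setIidPr s) -e subSnn.
  have nE : neighbours x = Q :\ q0 by rewrite -e0 setDDr setDv set0U (setIidPr s).
  have q0Q : q0 \in Q by have := set11 q0; rewrite -e0 inE => /andP[].
  transitivity #|[set q0]|; last by rewrite cards1.
  apply: eq_card => q; rewrite !inE xU /= nE.
  apply/andP/eqP => [[qQ /eqP/setP/(_ q)]|->]; last by rewrite q0Q.
  by rewrite !inE qQ eqxx /= andbT => /negbFE/eqP.
apply/eqP; rewrite cards_eq0; apply/eqP/setP => q; rewrite !inE xU /=.
apply/negP => /andP[qQ /eqP e]; apply: ne.
by rewrite e [in RHS](cardsD1 q) qQ.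
Qed.

Lemma card_pendants x : x \in U ->
  #|[set q in Q | x \in pendant q]| =
    (nat_of_bool (((clique_number_in U x).+1 == #|Q|) && (#|neighbours x|.+2 == #|Q|))).*2.
Proof.
move=> xU; have s := neighboursS x.
case: (boolP (_ && _)) => [/andP[h1 h2]|h].
  transitivity #|Q :\: neighbours x|; last by rewrite cardsD (setIidPr s) -(eqP h2) /=; lia.
  apply: eq_card => q; rewrite !inE xU h1 h2 /=.
  by case: (q \in Q) => //=; rewrite andbT.
apply/eqP; rewrite cards_eq0; apply/eqP/setP => q; rewrite !inE xU /=.
by apply: contraNF h => /and4P[_ -> ->].
Qed.

End MaximumClique.
End Cliques.

(** * Two numerical inequalities *)

(** One vertex q of Q contributes this much slack to the edge count around Q.
    Here d is the weighted degree of q, sg and x are the masses of its cell and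
    of its pendant vertices, and l measures the neighbours of q of clique number
    below rho - 1.  With x = l = 0 the slack is at least
    (1 - rho p)^2 / (rho (1 - p)), which explains the shape of the proof.  If
    rho p >= 1/2, the term rho (p - sg) alone absorbs x / 2.  Otherwise q has
    small degree, hence large mass in its neighbourhood, and the bound on x
    takes over. *)
Lemma clique_vertex_slack (R : realFieldType) (rho d sg x l e : R) (p := 1 - (rho - 1) / (rho * d)) :
  2 <= rho -> 0 < d -> 0 < p -> 0 <= sg -> 0 <= x -> 0 <= l ->
  x <= 1 - (rho - 2) / (rho - 1) * d + l ->
  e = Num.min p 2^-1 -> sg + e * x <= p ->
  0 <= (rho - 1) * d - (rho - 2) - rho * sg - x / 2 + l / 2
  /\ ((rho - 1) * d - (rho - 2) - rho * sg - x / 2 + l / 2 = 0 -> d = 1).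
Proof.
move=> rho2 d0 p0 sg0 x0 l0 xle eE sgle.
have rho0 : 0 < rho by lra.
have rd0 : 0 < rho * d by rewrite mulr_gt0.
have pE : rho * d * (1 - p) = rho - 1 by rewrite /p; field; rewrite !gt_eqF.
have y0 : 0 < 1 - p.
  by rewrite -(pmulr_rgt0 _ rd0) pE; lra.
clearbody p.
have dE : d = (rho - 1) / (rho * (1 - p)) by rewrite -pE; field; rewrite !gt_eqF.
have ry0 : 0 < rho * (1 - p) by rewrite mulr_gt0.
set b := _ + l / 2.
have fin (z : R) : 0 <= z -> b = (1 - rho * p) ^+ 2 / (rho * (1 - p)) + z ->
    0 <= b /\ (b = 0 -> d = 1).
  move=> z0 ->.
  have q0 : 0 <= (1 - rho * p) ^+ 2 / (rho * (1 - p)) by rewrite divr_ge0 ?sqr_ge0 ?ltW.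
  split=> [|h]; first by rewrite addr_ge0.
  have /eqP : (1 - rho * p) ^+ 2 / (rho * (1 - p)) = 0 by lra.
  rewrite mulf_eq0 sqrf_eq0 invr_eq0 (gt_eqF ry0) orbF => /eqP h1.
  have -> : d = (rho - 1) / (rho - 1) by rewrite {1}dE; congr (_ / _); lra.
  have r10 : 0 < rho - 1 by lra.
  by rewrite divff // gt_eqF.
have bE : b = (1 - rho * p) ^+ 2 / (rho * (1 - p)) + (rho * (p - sg) - x / 2 + l / 2).
  by rewrite /b {1}dE; field; rewrite !gt_eqF.
case: (leP (1 / 2) (rho * p)) => hp.
  apply: (fin _ _ bE).
  have h1 : 2^-1 <= rho * e.
    rewrite eE minEle; case: ifP => _; first lra.
    by have := ler_wpM2r (x := 2^-1 : R) ltac:(lra) rho2; lra.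
  have : rho * (e * x) <= rho * (p - sg) by rewrite ler_pM2l //; lra.
  have := ler_wpM2r x0 h1; lra.
have p2 : p < 2^-1 by rewrite -(ltr_pM2l rho0); lra.
have ep : e = p by rewrite eE minElt p2.
have h2 : rho * (p * x) <= rho * (p - sg) by rewrite ler_pM2l // -ep; lra.
have kd : (rho - 2) / (rho - 1) * d = (rho - 2) / (rho * (1 - p)).
  by rewrite dE; field; rewrite !gt_eqF //=; lra.
have h3 : (2^-1 - rho * p) * x <= (2^-1 - rho * p) * (1 - (rho - 2) / (rho * (1 - p)) + l).
  by rewrite -kd; apply: ler_wpM2l => //; lra.
have h4 : 0 < (rho * p / 2) / (rho * (1 - p)) by rewrite divr_gt0 // divr_gt0 ?mulr_gt0 //; lra.
have h5 : (1 - rho * p) ^+ 2 / (rho * (1 - p)) - (2^-1 - rho * p) * (1 - (rho - 2) / (rho * (1 - p)))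
   = (rho * p / 2) / (rho * (1 - p)).
  by field; rewrite !gt_eqF.
have h6 : 0 <= rho * p * l by rewrite !mulr_ge0 // ltW.
suff b0 : 0 < b by split; [exact: ltW | move=> h; rewrite h ltxx in b0].
rewrite bE; lra.
Qed.

(** A vertex of clique number c has a < c neighbours in the r-clique Q.  Divided
    by 1 - 1/c, the count (r - 1) a exceeds r (r - 2) only when a + 1 = r, that
    is, in a cell, or when c + 1 = a + 2 = r, that is, at a pendant vertex; a
    clique number below r - 1 leaves room to spare. *)
Lemma missing_count_le (R : realFieldType) (r c a : nat) :
  (1 < c)%N -> (c <= r)%N -> (a < c)%N ->
  (r%:R - 1) * a%:R <= (1 - c%:R^-1) *
    (r%:R * (r%:R - 2) + r%:R * (a.+1 == r)%:R + ((c.+1 == r) && (a.+2 == r))%:R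
     - (c.+1 < r)%:R * 2) :> R.
Proof.
move=> c1 cr ac.
have c0 : 0 < c%:R :> R by rewrite ltr0n; lia.
have c1R : 2 <= c%:R :> R by rewrite ler_nat.
rewrite -(ler_pM2l c0) [leRHS]mulrA [_ * (1 - _)]mulrBr mulr1 divff ?(gt_eqF c0) //.
have [->|rc] := eqVneq c r.
  have r2 : 2 <= r%:R :> R by rewrite ler_nat; lia.
  have -> : (r.+1 == r) = false by lia.
  have -> : (r.+1 < r)%N = false by lia.
  rewrite /= mul0r subr0 addr0.
  have [ar|ar] := eqVneq a.+1 r.
    have -> : a%:R = r%:R - 1 :> R by rewrite -ar -natr1 addrK.
    by rewrite mulr1; lra.
  have : a%:R <= r%:R - 2 :> R.
    by rewrite lerBrDr -natrD ler_nat; lia.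
  rewrite mulr0 addr0 => h.
  have h2 := ler_wpM2l (x := r%:R * (r%:R - 1)) ltac:(nra) h; lra.
have [cr1|cr1] := eqVneq c.+1 r.
  have a1 : (a.+1 == r) = false by lia.
  have -> : (c.+1 < r)%N = false by lia.
  rewrite a1 mul0r subr0 mulr0 addr0 /=.
  have rE : r%:R = c%:R + 1 :> R by rewrite -cr1 -natr1.
  rewrite rE; have [ar|ar] := eqVneq a.+2 r.
    have -> : a%:R = c%:R - 1 :> R.
      have -> : c = a.+1 by lia.
      by rewrite -natr1 addrK.
    by rewrite mulr1n; lra.
  have : a%:R <= c%:R - 2 :> R.
    by rewrite lerBrDr -natrD ler_nat; lia.
  rewrite addr0 => h.
  have h2 := ler_wpM2l (x := c%:R * c%:R) ltac:(nra) h; nra.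
have -> : (c.+1 < r)%N by lia.
have -> : (a.+1 == r) = false by lia.
rewrite /= mulr0 !addr0 mul1r.
have h : a%:R <= c%:R - 1 :> R by rewrite lerBrDr natr1 ler_nat; lia.
have h' : c%:R + 2 <= r%:R :> R by rewrite -natrD ler_nat; lia.
have h2 := ler_wpM2l (x := c%:R * (r%:R - 1)) ltac:(nra) h.
have h3 : 0 <= (c%:R - 1) * ((r%:R - 1) * (r%:R - 2 - c%:R) + (r%:R - 4)) :> R.
  by apply: mulr_ge0; nra.
lra.
Qed.

(** * Stationary weightings *)

Section Weights.
Variables (R : realFieldType) (G : sgraph) (U : {set G}).
Implicit Types (S X Q : {set G}) (u v x y q : G).

Definition turan_weight v : R := 1 - (clique_number_in U v)%:R^-1.

Lemma turan_weight_ge0 v : v \in U -> 0 <= turan_weight v.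
Proof.
move=> vU; rewrite subr_ge0 invf_le1 ?ler1n ?ltr0n; exact: clique_number_in_gt0.
Qed.

Lemma turan_weight_ge_half v : (1 < clique_number_in U v)%N -> 2^-1 <= turan_weight v.
Proof.
move=> c1; rewrite lerBrDr -lerBrDl.
have -> : 1 - 2^-1 = 2^-1 :> R by field.
by rewrite lef_pV2 ?posrE ?ltr0n ?ler_nat //; lia.
Qed.

Variables (w : G -> R) (Y : G -> G -> R).

Definition mass v : R := turan_weight v * w v.
Definition degree v : R := \sum_(u in U | adj v u) w u.

(** The first-order conditions at a maximum of value at least 1: w is the vector
    of squares of the weights and Y the entrywise square of the Gram matrix.
    [kernel_psd] is Cauchy-Schwarz for the semidefinite form Y between f and the
    constant 1, whose Y-value is the total mass 1; [edge_mass] is Cauchy-Schwarz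
    on one row. *)
Record stationary : Prop := Stationary {
  weight_gt0 : {in U, forall v, 0 < w v};
  no_isolated : {in U, forall v, exists2 u, u \in U & adj v u};
  total_mass : \sum_(v in U) mass v = 1;
  kernelC : forall u v, Y u v = Y v u;
  kernel_ge0 : forall u v, 0 <= Y u v;
  kernel_row : {in U, forall v, \sum_(u in U) Y v u = mass v};
  kernel_psd : forall f : G -> R, (\sum_(v in U) f v * mass v) ^+ 2
     <= \sum_(v in U) f v * (\sum_(u in U) f u * Y v u);
  edge_mass : {in U, forall v, turan_weight v ^+ 2 * w v
     <= degree v * \sum_(u in U | adj v u) Y v u }}.

Hypothesis st : stationary.

Lemma clique_number_gt1 v : v \in U -> (1 < clique_number_in U v)%N.
Proof.
by move=> vU; have [u uU] := no_isolated st vU; apply: clique_number_in_gt1.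
Qed.

Lemma turan_weight_gt0 v : v \in U -> 0 < turan_weight v.
Proof.
move=> /clique_number_gt1/turan_weight_ge_half; apply: lt_le_trans.
by rewrite invr_gt0 ltr0n.
Qed.

Lemma mass_gt0 v : v \in U -> 0 < mass v.
Proof. by move=> vU; rewrite mulr_gt0 ?turan_weight_gt0 ?(weight_gt0 st). Qed.

Lemma degree_gt0 v : v \in U -> 0 < degree v.
Proof.
move=> vU; have [u uU uv] := no_isolated st vU.
rewrite /degree (bigD1 u) ?uU //= ltr_wpDr ?(weight_gt0 st) //.
by apply: sumr_ge0 => z /andP[/andP[zU _] _]; apply/ltW/(weight_gt0 st).
Qed.

Lemma nonedge_mass v : v \in U ->
  \sum_(u in U | ~~ adj v u) Y v u <= mass v * (1 - turan_weight v / degree v).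
Proof.
move=> vU; have := kernel_row st vU; rewrite (bigID (adj v)) /= => e.
have d0 := degree_gt0 vU.
suff : mass v * (turan_weight v / degree v) <= \sum_(u in U | adj v u) Y v u.
  by move: e; lra.
rewrite mulrA ler_pdivrMr // /mass.
by have := edge_mass st vU; lra.
Qed.

Lemma sum_indicator S (f : G -> R) : S \subset U ->
  \sum_(v in U) (v \in S)%:R * f v = \sum_(v in S) f v.
Proof.
move=> SU; rewrite (big_setID S) (setIidPr SU) /= [X in _ + X]big1 ?addr0.
  by apply: eq_bigr => v ->; rewrite mul1r.
by move=> v; rewrite inE => /andP[/negPf -> _]; rewrite mul0r.
Qed.

(** Test vector: the indicator of S plus eps times that of X.  The pairs inside S
    and between S and X are non-edges; pairs inside X may be edges, but they
    come with the factor eps ^+ 2 and carry at most the mass of X.  The bound on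
    eps lets the cross terms, counted twice, fit in the rows of S. *)
Lemma stable_mass_sqr S X (eps : R) :
  S \subset U -> X \subset U -> [disjoint S & X] ->
  {in S &, forall x y, ~~ adj x y} -> {in S & X, forall x y, ~~ adj x y} ->
  0 <= eps <= 2^-1 ->
  (\sum_(v in S) mass v + eps * \sum_(v in X) mass v) ^+ 2
    <= \sum_(v in S) \sum_(u in U | ~~ adj v u) Y v u
       + eps ^+ 2 * \sum_(v in X) mass v.
Proof.
move=> SU XU dSX SS SX /andP[e0 e2].
pose f v : R := (v \in S)%:R + eps * (v \in X)%:R.
have fE (g : G -> R) : \sum_(v in U) f v * g v =
    \sum_(v in S) g v + eps * \sum_(v in X) g v.
  under eq_bigr => v _ do rewrite mulrDl -mulrA.
  by rewrite big_split /= -mulr_sumr !sum_indicator.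
have := kernel_psd st f; under [leRHS]eq_bigr => v _ do rewrite (fE (Y v)).
rewrite !fE => /le_trans; apply.
rewrite !big_split /= -!mulr_sumr.
have -> : \sum_(v in X) \sum_(u in S) Y v u = \sum_(v in S) \sum_(u in X) Y v u.
  rewrite exchange_big /=; apply: eq_bigr => v _; apply: eq_bigr => u _.
  exact: kernelC.
set a := \sum_(v in S) \sum_(u in S) Y v u.
set b := \sum_(v in S) \sum_(u in X) Y v u.
set c := \sum_(v in X) \sum_(u in X) Y v u.
have ab : a + b <= \sum_(v in S) \sum_(u in U | ~~ adj v u) Y v u.
  rewrite /a /b -big_split; apply: ler_sum => v vS.
  rewrite -bigU //=.
  rewrite big_mkcond [leRHS]big_mkcond /=; apply: ler_sum => u _.
  rewrite inE; case: (boolP (u \in S)) => uS /=.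
    by rewrite (subsetP SU u uS) SS.
  case: (boolP (u \in X)) => uX /=; first by rewrite (subsetP XU u uX) SX.
  by case: ifP => // _; apply: (kernel_ge0 st).
have cX : c <= \sum_(v in X) mass v.
  apply: ler_sum => v vX; have vU := subsetP XU v vX.
  rewrite -(kernel_row st vU) [leRHS](big_setID X) (setIidPr XU) /= lerDl.
  by apply: sumr_ge0 => u _; apply: (kernel_ge0 st).
have b0 : 0 <= b by apply: sumr_ge0 => v _; apply: sumr_ge0 => u _; apply: (kernel_ge0 st).
have := ler_wpM2l (sqr_ge0 eps) cX.
have : (1 - 2 * eps) * b >= 0 by apply: mulr_ge0 => //; lra.
lra.
Qed.
End Weights.

(** * The structure of a stationary weighting *)

Section Core.
Variables (R : realFieldType) (G : sgraph) (U : {set G}).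
Variables (w : G -> R) (Y : G -> G -> R).
Hypothesis st : stationary U w Y.
Implicit Types (S X Q : {set G}) (u v x y q : G).

Let k := turan_weight R U.
Let m := mass U w.
Let d := degree U w.

Lemma sum_memberships Q (S : G -> {set G}) (F : G -> R) :
  (forall q, S q \subset U) ->
  \sum_(q in Q) \sum_(x in S q) F x =
  \sum_(x in U) F x * #|[set q in Q | x \in S q]|%:R.
Proof.
move=> SU; rewrite (exchange_big_dep (mem U)) /=; last first.
  by move=> q x _ /(subsetP (SU q)).
apply: eq_bigr => x _; rewrite mulr_natr -sumr_const.
by apply: eq_bigl => q; rewrite inE.
Qed.

(** Among the largest cliques take one of maximal total degree; exchanging q for
    a vertex of its cell cannot increase that total. *)
Lemma maximum_clique : U != set0 ->
  exists Q : {set G}, [/\ Q \subset U, clique Q, (1 < #|Q|)%N,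
    {in U, forall v, (clique_number_in U v <= #|Q|)%N} &
    {in Q, forall q, {in cell U Q q, forall x, d x <= d q}}].
Proof.
case/set0Pn => v vU.
have U0 : (0 < #|U|)%N by apply/card_gt0P; exists v.
have [v0 v0U e] := eq_bigmax_cond (clique_number_in U) U0.
have [Q0 [v0Q0 Q0U cQ0] cardQ0] := clique_number_in_attained v0U.
pose r := clique_number_in U v0.
have rmax : {in U, forall x, (clique_number_in U x <= r)%N}.
  by move=> x xU; rewrite /r -e; apply: leq_bigmax_cond.
pose P Q := [&& Q \subset U, clique Q & #|Q| == r].
have P0 : P Q0 by rewrite /P Q0U cQ0 cardQ0 eqxx.
case: (arg_maxP (fun Q : {set G} => \sum_(q in Q) d q) P0) => Q.
case/and3P => QU cQ /eqP rQ Qext; exists Q; rewrite rQ.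
split=> // [|q qQ x xc]; first exact: (clique_number_gt1 st v0U).
have Qmax : {in U, forall x, (clique_number_in U x <= #|Q|)%N} by rewrite rQ.
have [QU' cQ' rQ'] := cell_exchange QU cQ qQ xc.
have := Qext (x |: Q :\ q); rewrite /P QU' cQ' rQ' rQ eqxx => /(_ isT).
have [_ _ h] := cellP qQ xc.
rewrite big_setU1 /= ?(big_setD1 q qQ) ?lerD2r //.
by apply/negP => /h; rewrite adj_irrefl.
Qed.

Section AroundClique.
Variable Q : {set G}.
Hypotheses (QU : Q \subset U) (cQ : clique Q) (Q1 : (1 < #|Q|)%N).
Hypothesis Qmax : {in U, forall v, (clique_number_in U v <= #|Q|)%N}.
Hypothesis Qext : {in Q, forall q, {in cell U Q q, forall x, d x <= d q}}.

Let r : R := #|Q|%:R.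
Let cell_mass q := \sum_(x in cell U Q q) m x.
Let pendant_mass q := \sum_(x in pendant U Q q) m x.
Let defect q := 1 - (r - 1) / (r * d q).
Let low x := ((clique_number_in U x).+1 < #|Q|)%N.
Let excess q := \sum_(u in U | adj q u && low u) ((r - 2) / (r - 1) - k u) * w u.

Let r2 : 2 <= r. Proof. by rewrite ler_nat. Qed.

Lemma sum_degrees : \sum_(q in Q) d q = \sum_(x in U) w x * #|neighbours Q x|%:R.
Proof.
transitivity (\sum_(q in Q) \sum_(x in [set u in U | adj q u]) w x).
  by apply: eq_bigr => q _; apply: eq_bigl => u; rewrite inE.
rewrite sum_memberships; last by move=> q; apply/subsetP => x; rewrite inE => /andP[].
apply: eq_bigr => x xU; congr (_ * _%:R); apply: eq_card => q.
by rewrite !inE xU adj_sym.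
Qed.

(** Both sides count weighted edges between U and Q; [missing_count_le] bounds
    the contribution of each vertex of U.  Every cell vertex lies in one cell,
    every pendant vertex is counted at the two vertices that it misses. *)
Lemma sum_degrees_le : (r - 1) * \sum_(q in Q) d q <=
  r * (r - 2) + r * (\sum_(q in Q) cell_mass q) + (\sum_(q in Q) pendant_mass q) / 2
  - 2 * \sum_(x in U | low x) m x.
Proof.
rewrite sum_degrees.
rewrite /cell_mass sum_memberships; last by move=> q; apply/subsetP => x; rewrite inE => /andP[].
rewrite /pendant_mass sum_memberships; last by move=> q; apply/subsetP => x; rewrite inE => /andP[].
have -> : r * (r - 2) = \sum_(x in U) r * (r - 2) * m x.
  by rewrite -mulr_sumr (total_mass st) mulr1.
rewrite [X in _ - 2 * X]big_mkcondr mulr_suml !mulr_sumr /= -!big_split /= -sumrB.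
apply: ler_sum => x xU; rewrite card_cells // card_pendants //.
have := missing_count_le R (clique_number_gt1 st xU) (Qmax xU)
  (card_neighbours QU cQ xU).
move/(ler_wpM2r (ltW (weight_gt0 st xU))); rewrite -/r -/(low x) -muln2 natrM.
rewrite /m /mass /turan_weight.
by case: (low x); case: (_ && _); case: (_ == _); rewrite /= ?mulr1 ?mulr0; lra.
Qed.

Lemma turan_weight_clique q x : q \in Q -> x \in cell U Q q -> k x = (r - 1) / r.
Proof.
move=> qQ xc; have r0 : r != 0 by rewrite gt_eqF // ltr0n; lia.
rewrite /k /turan_weight (clique_number_in_cell QU cQ Qmax qQ xc) -/r.
by field.
Qed.

Lemma cellS q : cell U Q q \subset U.
Proof. by apply/subsetP => x; rewrite inE => /andP[]. Qed.

Lemma pendantS q : pendant U Q q \subset U.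
Proof. by apply/subsetP => x; rewrite inE => /andP[]. Qed.

Lemma cell_mass_gt0 q : q \in Q -> 0 < cell_mass q.
Proof.
move=> qQ; rewrite /cell_mass (bigD1 q) ?mem_cell //=.
rewrite ltr_wpDr ?(mass_gt0 st) ?(subsetP QU) //.
by apply: sumr_ge0 => x /andP[/(subsetP (cellS q)) xU _]; apply/ltW/(mass_gt0 st).
Qed.

Lemma pendant_mass_ge0 q : 0 <= pendant_mass q.
Proof.
by apply: sumr_ge0 => x /(subsetP (pendantS q)) xU; apply/ltW/(mass_gt0 st).
Qed.

(** All vertices of the cell have the weight of Q, and q has maximal degree. *)
Lemma defect_le q x : q \in Q -> x \in cell U Q q -> 1 - k x / d x <= defect q.
Proof.
move=> qQ xc; have xU := subsetP (cellS q) x xc.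
have dx := degree_gt0 st xU; have dq := degree_gt0 st (subsetP QU q qQ).
have r0 : 0 < r by have := r2; lra.
rewrite (turan_weight_clique qQ xc) /defect lerD2l lerN2 -mulrA -invfM.
rewrite ler_pM2l ?subr_gt0; last by have := r2; lra.
by rewrite lef_pV2 ?posrE ?mulr_gt0 // ler_pM2l // Qext.
Qed.

Lemma cell_defect q : q \in Q ->
  \sum_(x in cell U Q q) \sum_(u in U | ~~ adj x u) Y x u <= cell_mass q * defect q.
Proof.
move=> qQ; rewrite mulr_suml; apply: ler_sum => x xc.
have xU := subsetP (cellS q) x xc.
apply: le_trans (nonedge_mass st xU) _.
by rewrite ler_pM2l ?(mass_gt0 st) // defect_le.
Qed.

Lemma cell_pendant_sqr q (eps : R) : q \in Q -> 0 <= eps <= 2^-1 ->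
  (cell_mass q + eps * pendant_mass q) ^+ 2 <= cell_mass q * defect q + eps ^+ 2 * pendant_mass q.
Proof.
move=> qQ he; apply: le_trans (lerD (cell_defect qQ) (lexx _)).
apply: (stable_mass_sqr st (cellS q) (pendantS q)) => //.
- rewrite disjoint_subset; apply/subsetP => x xc; rewrite !inE.
  by rewrite (clique_number_in_cell QU cQ Qmax qQ xc) eqn_leq ltnn !andbF.
- by move=> x y; apply: (cell_stable QU cQ Qmax qQ).
- by move=> x y; apply: (cell_pendant QU cQ qQ).
Qed.

Lemma defect_gt0 q : q \in Q -> 0 < defect q.
Proof.
move=> qQ; have := cell_pendant_sqr (eps := 0) qQ.
rewrite lexx invr_ge0 ler0n => /(_ isT); rewrite !mul0r expr0n !mul0r !addr0 expr2.
have s0 := cell_mass_gt0 qQ; rewrite ler_pM2l //; exact: lt_le_trans.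
Qed.

(** The coefficient must be at most 1/2 for the test vector to apply, and at most
    the defect so that the quadratic term it leaves is absorbed on the right. *)
Lemma cell_pendant_le q : q \in Q -> cell_mass q + Num.min (defect q) 2^-1 * pendant_mass q <= defect q.
Proof.
move=> qQ; set e := Num.min _ _.
have p0 := defect_gt0 qQ; have s0 := cell_mass_gt0 qQ; have x0 := pendant_mass_ge0 q.
have e0 : 0 <= e by rewrite /e le_min (ltW p0) invr_ge0 ler0n.
have ep : e <= defect q by rewrite /e ge_min lexx.
have e2 : e <= 2^-1 by rewrite /e ge_min lexx orbT.
have := cell_pendant_sqr (eps := e) qQ; rewrite e0 e2 => /(_ isT) h.
have h2 : e * (e * pendant_mass q) <= defect q * (e * pendant_mass q) by rewrite ler_wpM2r // mulr_ge0.
have t0 : 0 < cell_mass q + e * pendant_mass q by rewrite ltr_wpDr ?mulr_ge0.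
by rewrite -(ler_pM2l t0); lra.
Qed.

Let lower_weight : R := (r - 2) / (r - 1).

Lemma lower_weightE : lower_weight = 1 - (r - 1)^-1.
Proof. by rewrite /lower_weight; field; rewrite gt_eqF //; have := r2; lra. Qed.

Lemma low_weight_le u : u \in U -> low u -> k u <= lower_weight.
Proof.
rewrite /low => uU lu; have r0 : 0 < r - 1 by have := r2; lra.
rewrite lower_weightE lerD2l lerN2 lef_pV2 ?posrE ?ltr0n //; last first.
  exact: clique_number_in_gt0 uU.
by rewrite lerBrDr natr1 ler_nat; lia.
Qed.

Lemma high_weight_ge u : u \in U -> ~~ low u -> lower_weight <= k u.
Proof.
rewrite /low => uU lu; have r0 : 0 < r - 1 by have := r2; lra.
rewrite lower_weightE lerD2l lerN2 lef_pV2 ?posrE ?ltr0n //; last first.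
  exact: clique_number_in_gt0 uU.
by rewrite lerBlDr natr1 ler_nat; lia.
Qed.

Lemma excess_ge0 q : 0 <= excess q.
Proof.
apply: sumr_ge0 => u /and3P[uU _ lu].
apply: mulr_ge0; first by rewrite subr_ge0 low_weight_le.
exact/ltW/(weight_gt0 st).
Qed.

(** A vertex of clique number c is counted at fewer than c vertices of Q. *)
Lemma sum_excess_le : \sum_(q in Q) excess q <= \sum_(x in U | low x) m x.
Proof.
pose F u := if low u then (lower_weight - k u) * w u else 0.
have -> : \sum_(q in Q) excess q = \sum_(q in Q) \sum_(u in [set u in U | adj q u]) F u.
  apply: eq_bigr => q _; rewrite /excess /F -big_mkcondr /=.
  by apply: eq_bigl => u; rewrite inE andbA.
rewrite sum_memberships; last by move=> q; apply/subsetP => x; rewrite inE => /andP[].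
rewrite big_mkcondr; apply: ler_sum => u uU; rewrite /F.
case: ifP => lu; last by rewrite mul0r.
have -> : [set q in Q | u \in [set u in U | adj q u]] = neighbours Q u.
  by apply/setP => q; rewrite !inE uU adj_sym.
have c0 : 0 < (clique_number_in U u)%:R :> R by rewrite ltr0n clique_number_in_gt0.
have a1 : #|neighbours Q u|%:R + 1 <= (clique_number_in U u)%:R :> R.
  by rewrite natr1 ler_nat card_neighbours.
have w0 := weight_gt0 st uU.
rewrite /m /mass mulrAC ler_wpM2r ?(ltW w0) //.
have pk := low_weight_le uU lu.
apply: (@le_trans _ _ ((lower_weight - k u) * ((clique_number_in U u)%:R - 1))).
  by rewrite ler_wpM2l ?subr_ge0 //; lra.
have p1 : lower_weight <= 1.
  by rewrite lower_weightE lerBlDr lerDl invr_ge0; have := r2; lra.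
have kE : (clique_number_in U u)%:R * (1 - k u) = 1.
  by rewrite /k /turan_weight opprB addrC subrK mulfV ?gt_eqF.
have h : (lower_weight - k u) * ((clique_number_in U u)%:R - 1)
   <= (1 - k u) * ((clique_number_in U u)%:R - 1).
  apply: ler_wpM2r; last lra.
  by rewrite subr_ge0 ler1n clique_number_in_gt0.
by apply: le_trans h _; rewrite -/(k u); lra.
Qed.

(** The pendant vertices at q are not neighbours of q, and a neighbour has weight
    at least (r - 2) / (r - 1) up to the excess. *)
Lemma pendant_mass_le q : q \in Q -> pendant_mass q <= 1 - lower_weight * d q + excess q.
Proof.
move=> qQ; have dis : [disjoint pendant U Q q & [set u in U | adj q u]].
  rewrite disjoint_subset; apply/subsetP => x; rewrite !inE.
  by case/and4P => _ _ _; rewrite adj_sym => /negPf ->; rewrite andbF.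
have h : pendant_mass q + \sum_(u in [set u in U | adj q u]) m u <= 1.
  rewrite -(total_mass st) [leRHS](big_setID (pendant U Q q)) /=.
  rewrite (setIidPr (pendantS q)) lerD2l.
  rewrite [leRHS](big_setID [set u in U | adj q u]) /= (setIidPr _).
    rewrite lerDl; apply: sumr_ge0 => x; rewrite 2!inE => /andP[_].
    by rewrite inE => /andP[_ xU]; apply/ltW/(mass_gt0 st).
  apply/subsetP => x xN; rewrite inE (disjointFl dis xN).
  by move: xN; rewrite inE => /andP[].
have h2 : lower_weight * d q - excess q <= \sum_(u in [set u in U | adj q u]) m u.
  under [leRHS]eq_bigl => u do rewrite inE.
  have -> : excess q = \sum_(u in U | adj q u) if low u then (lower_weight - k u) * w u else 0.
    by rewrite -big_mkcondr /=; apply: eq_bigl => u; rewrite andbA.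
  rewrite /d /degree mulr_sumr -sumrB; apply: ler_sum => u /andP[uU _].
  rewrite /m /mass; case: ifP => lu; first by rewrite mulrBl opprB addrC subrK.
  by rewrite subr0 ler_wpM2r ?(ltW (weight_gt0 st uU)) // high_weight_ge ?lu.
lra.
Qed.

Lemma slack_ge0 q : q \in Q ->
  let b := (r - 1) * d q - (r - 2) - r * cell_mass q - pendant_mass q / 2 + excess q / 2 in
  0 <= b /\ (b = 0 -> d q = 1).
Proof.
move=> qQ; apply: (clique_vertex_slack (e := Num.min (defect q) 2^-1)) => //.
- exact: (degree_gt0 st (subsetP QU q qQ)).
- exact: defect_gt0.
- exact/ltW/cell_mass_gt0.
- exact: pendant_mass_ge0.
- exact: excess_ge0.
- exact: pendant_mass_le.
- exact: cell_pendant_le.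
Qed.

(** The slacks are non-negative and [sum_degrees_le] makes their sum
    non-positive, so all of them vanish. *)
Lemma tight : (forall x, x \in U -> ~~ low x) /\
  {in Q, forall q, d q = 1 /\ r * cell_mass q + pendant_mass q / 2 = 1}.
Proof.
pose b q := (r - 1) * d q - (r - 2) - r * cell_mass q - pendant_mass q / 2 + excess q / 2.
have b0 : forall q, q \in Q -> 0 <= b q by move=> q /slack_ge0[].
have sb : \sum_(q in Q) b q = (r - 1) * (\sum_(q in Q) d q) - r * (r - 2)
    - r * (\sum_(q in Q) cell_mass q) - (\sum_(q in Q) pendant_mass q) / 2
    + (\sum_(q in Q) excess q) / 2.
  rewrite /b !big_split /= !sumrN -!mulr_sumr -!mulr_suml sumr_const.
  by rewrite -[_ *+ #|Q|]mulr_natr -/r; ring.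
have low0 : 0 <= \sum_(x in U | low x) m x.
  by apply: sumr_ge0 => x /andP[xU _]; apply/ltW/(mass_gt0 st).
have sb0 : 0 <= \sum_(q in Q) b q by apply: sumr_ge0.
have ub := sum_degrees_le; have ue := sum_excess_le.
have nolow x : x \in U -> ~~ low x.
  move=> xU; apply/negP => lx.
  have : m x <= \sum_(x in U | low x) m x.
    rewrite (bigD1 x) ?xU //= lerDl.
    by apply: sumr_ge0 => y /andP[/andP[yU _] _]; apply/ltW/(mass_gt0 st).
  have := mass_gt0 st xU; rewrite -/(m x); lra.
have ex0 q : excess q = 0.
  by rewrite /excess big1 // => u /and3P[uU _]; rewrite (negPf (nolow u uU)).
split=> // q qQ.
have bq : b q = 0.
  have sb1 : \sum_(q in Q) b q = 0 by apply/eqP; rewrite eq_le sb0 andbT sb; lra.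
  by move/eqP: sb1; rewrite psumr_eq0 // => /allP /(_ q (mem_index_enum _)); rewrite qQ => /eqP.
have [_ /(_ bq) dq] := slack_ge0 qQ; split=> //.
by move: bq; rewrite /b dq ex0; lra.
Qed.

(** With defect 1/r the test vector with coefficient 1/(2r) reaches equality
    only if the pendant vertices have no mass. *)
Lemma pendant_mass_eq0 q : q \in Q -> pendant_mass q = 0 /\ cell_mass q = r^-1.
Proof.
move=> qQ; have [_ /(_ q qQ)[dq e]] := tight.
have r0 : 0 < r by have := r2; lra.
have pE : defect q = r^-1 by rewrite /defect dq; field; rewrite gt_eqF.
(* any coefficient below the defect 1/r works; 1/(2r) makes the slack cancel *)
pose z : R := (2 * r)^-1.
have zE : r^-1 = 2 * z by rewrite /z; field; rewrite gt_eqF.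
have z0 : 0 < z by rewrite invr_gt0 mulr_gt0.
have z2 : z <= 2^-1.
  by rewrite lef_pV2 ?posrE ?mulr_gt0 //; have := r2; lra.
have sE : cell_mass q = 2 * z - z * pendant_mass q.
  apply: (mulfI (lt0r_neq0 r0)).
  have -> : r * (2 * z - z * pendant_mass q) = 1 - pendant_mass q / 2.
    by rewrite /z; field; rewrite gt_eqF.
  by lra.
have := cell_pendant_sqr (eps := z) qQ; rewrite (ltW z0) z2 => /(_ isT).
rewrite pE zE sE => h.
have x0 := pendant_mass_ge0 q.
have xz : pendant_mass q = 0.
  apply/eqP; rewrite eq_le x0 andbT -(pmulr_rle0 _ (mulr_gt0 z0 z0)).
  by move: h; lra.
by rewrite xz; split=> //; lra.
Qed.

(** The cells have mass 1/r each, so together they carry the total mass. *)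
Lemma in_some_cell x : x \in U -> exists2 q, q \in Q & x \in cell U Q q.
Proof.
move=> xU.
have r0 : 0 < r by have := r2; lra.
have s1 : \sum_(q in Q) cell_mass q = 1.
  rewrite (eq_bigr (fun=> r^-1)); last by move=> q /pendant_mass_eq0[].
  by rewrite sumr_const -[_ *+ _]mulr_natr -/r mulVf ?gt_eqF.
pose a x := (#|neighbours Q x|.+1 == #|Q|).
have : \sum_(x in U) m x * (~~ a x)%:R = 0.
  have : \sum_(x in U) m x * (a x)%:R = 1.
    rewrite -[RHS]s1 /cell_mass (sum_memberships _ _ cellS).
    by apply: eq_bigr => y yU; rewrite card_cells.
  move=> sa; transitivity (\sum_(y in U) m y - \sum_(y in U) m y * (a y)%:R).
    rewrite -sumrB.
    by apply: eq_bigr => y _; case: (a y); rewrite /= ?mulr1 ?mulr0 ?subrr ?subr0.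
  by rewrite sa (total_mass st) subrr.
move/eqP; rewrite psumr_eq0 => [|y yU]; last first.
  by rewrite mulr_ge0 ?ler0n ?(ltW (mass_gt0 st yU)).
move/allP/(_ x (mem_index_enum _)); rewrite xU /= mulf_eq0 gt_eqF ?(mass_gt0 st) //=.
rewrite pnatr_eq0 eqb0 negbK => ax.
have := card_cells Q xU; rewrite -/(a x) ax => c1.
have /card_gt0P[q] : (0 < #|[set q in Q | x \in cell U Q q]|)%N by rewrite c1.
by rewrite inE => /andP[]; exists q.
Qed.

(** A cell meets the stable-set bound with equality, which propagates to each of
    its vertices. *)
Lemma cell_defect_eq q x : q \in Q -> x \in cell U Q q ->
  d x = 1 /\ d x * \sum_(u in U | adj x u) Y x u = k x ^+ 2 * w x.
Proof.
move=> qQ xc; have [_ /(_ q qQ)[dq e]] := tight.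
have [x0 sE] := pendant_mass_eq0 qQ.
have r0 : 0 < r by have := r2; lra.
have pE : defect q = r^-1 by rewrite /defect dq; field; rewrite gt_eqF.
pose n y := \sum_(u in U | ~~ adj y u) Y y u.
have nle y : y \in cell U Q q -> n y <= m y * (1 - k y / d y) <= m y * r^-1.
  move=> yc; have yU := subsetP (cellS q) y yc.
  by rewrite (nonedge_mass st yU) -pE ler_pM2l ?(mass_gt0 st) // defect_le.
have : \sum_(y in cell U Q q) (m y * r^-1 - n y) = 0.
  apply/eqP; rewrite eq_le sumr_ge0 ?andbT; last first.
    by move=> y /nle/andP[h1 h2]; rewrite subr_ge0 (le_trans h1).
  rewrite sumrB -mulr_suml subr_le0 -/(cell_mass q).
  have := @stable_mass_sqr _ _ _ _ _ st (cell U Q q) set0 0 (cellS q) (sub0set _).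
  rewrite lexx invr_ge0 ler0n mul0r expr0n mul0r !addr0 => h.
  have -> : cell_mass q * r^-1 = cell_mass q ^+ 2 by rewrite expr2 {3}sE.
  apply: h => //.
  - by rewrite -setI_eq0 setI0.
  - by move=> y z; apply: (cell_stable QU cQ Qmax qQ).
  - by move=> y z _; rewrite inE.
move/eqP; rewrite psumr_eq0 => [|y /nle/andP[h1 h2]]; last first.
  by rewrite subr_ge0 (le_trans h1).
move/allP/(_ x (mem_index_enum _)); rewrite xc /= subr_eq0 => /eqP nx.
have xU := subsetP (cellS q) x xc.
have /andP[h1 h2] := nle x xc.
have mx := mass_gt0 st xU; have dx := degree_gt0 st xU.
have kx : m x * (1 - k x / d x) = m x * r^-1 by apply/eqP; rewrite eq_le h2 nx h1.
have kd : k x / d x = (r - 1) / r.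
  move/(mulfI (lt0r_neq0 mx)): kx => kx.
  have -> : (r - 1) / r = 1 - r^-1 by field; rewrite gt_eqF.
  by lra.
have r1 : r - 1 != 0 by rewrite gt_eqF //; have := r2; lra.
have d1 : d x = 1.
  move: kd; rewrite (turan_weight_clique qQ xc).
  move/(canRL (divfK _)); rewrite gt_eqF // => /(_ isT) /eqP.
  have rr : (r - 1) / r != 0 by rewrite mulf_neq0 // invr_eq0 gt_eqF.
  by rewrite -{1}[(r - 1) / r]mulr1 => /eqP/(mulfI rr).
split=> //; rewrite d1 mul1r.
have := kernel_row st xU; rewrite (bigID (adj x)) /= -/(n x) -nx -kx d1 divr1.
by rewrite -/(m x) /m /mass -/(k x); lra.
Qed.

End AroundClique.

(** The map p sends a vertex to the vertex of Q in whose cell it lies.  A vertex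
    has degree 1, which is the whole weight outside its cell, so it is adjacent
    to everything there.  The last clause is equality in [edge_mass]. *)
Lemma stationary_structure : U != set0 ->
  exists Q : {set G}, exists p : G -> G,
  [/\ (1 < #|Q|)%N, {in U, forall x, p x \in Q},
      {in U &, forall x y, adj x y = (p x != p y)},
      {in Q, forall q, \sum_(x in U | p x == q) w x = (#|Q|%:R - 1)^-1} &
      {in U, forall x,
        d x * \sum_(u in U | adj x u) Y x u = k x ^+ 2 * w x}].
Proof.
move=> /maximum_clique[Q [QU cQ Q1 Qmax Qext]].
have cov := in_some_cell QU cQ Q1 Qmax Qext.
pose p x := odflt x [pick q in Q | x \in cell U Q q].
have pP x : x \in U -> p x \in Q /\ x \in cell U Q (p x).
  move=> xU; rewrite /p; case: pickP => [q /andP[]//|h].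
  by have [q qQ xc] := cov x xU; have := h q; rewrite qQ xc.
have p_uniq x q : q \in Q -> x \in cell U Q q -> p x = q.
  move=> qQ xc; have [xU _ _] := cellP qQ xc.
  have [pQ] := pP x xU; move: xc; rewrite !inE => /andP[_ /eqP->] /andP[_ /eqP].
  move/setP/(_ q); rewrite !inE eqxx qQ andbT /= => /esym h.
  by apply/eqP; rewrite eq_sym; move: h; rewrite andbT => /negbFE.
have r0 : 0 < #|Q|%:R - 1 :> R by rewrite subr_gt0 ltr1n.
have wcell q : q \in Q -> \sum_(x in cell U Q q) w x = (#|Q|%:R - 1)^-1.
  move=> qQ; have [_ s] := pendant_mass_eq0 QU cQ Q1 Qmax Qext qQ.
  have rn : (#|Q|%:R - 1) / #|Q|%:R != 0 :> R.
    by rewrite mulf_neq0 ?invr_eq0 ?gt_eqF // ltr0n; lia.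
  apply: (mulfI rn); rewrite mulr_sumr.
  have -> : (#|Q|%:R - 1) / #|Q|%:R * (#|Q|%:R - 1)^-1 = #|Q|%:R^-1 :> R.
    by field; rewrite !gt_eqF // ltr0n; lia.
  rewrite -[RHS]s; apply: eq_bigr => x xc.
  by rewrite /m /mass -/(k x) (turan_weight_clique QU cQ Q1 Qmax qQ xc).
have mem_cellE q x : q \in Q -> (x \in cell U Q q) = (x \in U) && (p x == q).
  move=> qQ; apply/idP/andP => [xc|[xU /eqP <-]]; last by have [] := pP x xU.
  by have [xU _ _] := cellP qQ xc; rewrite (p_uniq x q).
exists Q, p; split=> //.
- by move=> x /pP[].
- move=> x y xU yU; have [pQ xc] := pP x xU; have [pyQ yc] := pP y yU.
  have [pE|pN] /= := eqVneq (p x) (p y).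
    by apply/negbTE/(cell_stable QU cQ Qmax pQ) => //; rewrite pE.
  have [dx _] := cell_defect_eq QU cQ Q1 Qmax Qext pQ xc.
  have wU : \sum_(z in U | p z != p x) w z = 1.
    have sU : \sum_(z in U) w z = #|Q|%:R / (#|Q|%:R - 1).
      rewrite (partition_big p (mem Q)) /=; last by move=> z /pP[].
      rewrite (eq_bigr (fun=> (#|Q|%:R - 1)^-1)).
        by rewrite sumr_const -[_ *+ _]mulr_natl.
      move=> q qQ; rewrite -(wcell q qQ); apply: eq_bigl => z.
      by rewrite mem_cellE.
    move: sU; rewrite (bigID (fun z => p z == p x)) /=.
    have -> : \sum_(z in U | p z == p x) w z = (#|Q|%:R - 1)^-1.
      by rewrite -(wcell _ pQ); apply: eq_bigl => z; rewrite mem_cellE.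
    move/(canRL (addKr _)) ->.
    by field; rewrite gt_eqF.
  apply/negPn/negP => nxy.
  have : d x < 1.
    rewrite -[ltRHS]wU (bigD1 y) /=; last by rewrite yU eq_sym.
    rewrite ltr_pwDl ?(weight_gt0 st) // /d /degree big_mkcond [leRHS]big_mkcond /=.
    apply: ler_sum => z _; case: ifP => [/andP[zU xz]|_]; last first.
      by case: ifP => // /andP[/andP[zU _] _]; apply/ltW/(weight_gt0 st).
    have -> : p z != p x.
      apply/eqP => zx; have := cell_stable QU cQ Qmax pQ xc (y := z).
      by rewrite mem_cellE // zU zx eqxx xz => /(_ isT).
    have -> : z != y by apply: contraNneq nxy => <-.
    by rewrite zU.
  by rewrite dx ltxx.
- move=> q qQ; rewrite -(wcell q qQ); apply: eq_bigl => x.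
  by rewrite mem_cellE.
- move=> x xU; have [pQ xc] := pP x xU.
  by have [_] := cell_defect_eq QU cQ Q1 Qmax Qext pQ xc.
Qed.
End Core.

(** * Quadratic forms on edges and their maxima *)

(** The first-order condition at a maximum, without derivatives. *)
Lemma linear_le_square_eq0 (R : realFieldType) (b C : R) :
  (forall e, `|e| <= 1 -> e * b <= e ^+ 2 * C) -> b = 0.
Proof.
move=> h; apply/eqP; apply: contraT => b0.
pose t := (1 + `|b| + `|C|)^-1.
have b1 : 0 < `|b| by rewrite normr_gt0.
have D0 : 0 < 1 + `|b| + `|C| by have := normr_ge0 C; lra.
have t0 : 0 < t by rewrite invr_gt0.
have tD : t * (1 + `|b| + `|C|) = 1 by rewrite mulVf ?gt_eqF.
clearbody t.
have tC : 0 <= t * `|C| by rewrite mulr_ge0 // ltW.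
have tb : 0 < t * `|b| by rewrite mulr_gt0.
have : `|b * t| <= 1 by rewrite normrM (gtr0_norm t0); move: tD; lra.
have bb : 0 < b ^+ 2 by rewrite lt0r sqrf_eq0 b0 sqr_ge0.
move/h; rewrite exprMn.
have -> : b * t * b = b ^+ 2 * t by ring.
rewrite -[leRHS]mulrA ler_pM2l // => h1.
have h2 := ler_wpM2l (ltW t0) (ler_wpM2l (ltW t0) (ler_norm C)).
have h3 : t * (t * `|C|) < t * 1 by rewrite ltr_pM2l //; move: tD; lra.
by exfalso; lra.
Qed.

Lemma cauchy_schwarz (R : realFieldType) (I : finType) (P : pred I) (x y : I -> R) :
  (\sum_(i | P i) x i * y i) ^+ 2 <=
  (\sum_(i | P i) x i ^+ 2) * (\sum_(i | P i) y i ^+ 2).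
Proof.
have : 0 <= \sum_(i | P i) \sum_(j | P j) (x i * y j - x j * y i) ^+ 2.
  by apply: sumr_ge0 => i _; apply: sumr_ge0 => j _; apply: sqr_ge0.
have -> : \sum_(i | P i) \sum_(j | P j) (x i * y j - x j * y i) ^+ 2 =
    \sum_(i | P i) \sum_(j | P j) (x i ^+ 2 * y j ^+ 2 + y i ^+ 2 * x j ^+ 2
      - 2 * ((x i * y i) * (x j * y j))).
  by apply: eq_bigr => i _; apply: eq_bigr => j _; ring.
under eq_bigr => i _ do rewrite sumrB big_split /= -!mulr_sumr.
rewrite sumrB big_split /= -!mulr_suml -!mulr_sumr -!mulr_suml.
by rewrite expr2; lra.
Qed.

Section Gram.
Variables (R : realFieldType) (G : sgraph) (U : {set G}) (J : finType).
Implicit Types (g : G -> J -> R) (a b : G -> R).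

Definition gram g u v : R := \sum_j g u j * g v j.
Definition gram_norm g : R := \sum_(u in U) \sum_(v in U) gram g u v ^+ 2.
Definition weight_form a : R := \sum_(v in U) turan_weight R U v * a v ^+ 2.
Definition edge_form g a b : R :=
  \sum_(u in U) \sum_(v in U | adj u v) gram g u v * (a u * b v).
Definition edge_row g a v : R := \sum_(u in U | adj v u) gram g v u * a u.

Lemma gramC g u v : gram g u v = gram g v u.
Proof. by apply: eq_bigr => j _; rewrite mulrC. Qed.

Lemma edge_form_row g a b : edge_form g a b = \sum_(u in U) a u * edge_row g b u.
Proof.
apply: eq_bigr => u _; rewrite mulr_sumr; apply: eq_bigr => v _; ring.
Qed.

Lemma edge_formC g a b : edge_form g a b = edge_form g b a.
Proof.
rewrite /edge_form (exchange_big_dep (mem U)) /=; last by move=> u v _ /andP[].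
apply: eq_bigr => v vU; apply: eq_big => [u|u _]; first by rewrite vU adj_sym.
by rewrite gramC [a u * _]mulrC.
Qed.

Lemma edge_formD g a b c : edge_form g a (fun v => b v + c v) =
  edge_form g a b + edge_form g a c.
Proof.
rewrite /edge_form -big_split; apply: eq_bigr => u _.
by rewrite -big_split; apply: eq_bigr => v _; rewrite /= !mulrDr.
Qed.

Lemma edge_formZ g a b e : edge_form g a (fun v => e * b v) = e * edge_form g a b.
Proof.
rewrite /edge_form mulr_sumr; apply: eq_bigr => u _.
by rewrite mulr_sumr; apply: eq_bigr => v _; ring.
Qed.

Definition unit_at x : G -> R := fun v => (v == x)%:R.

Lemma sum_unit_at x (F : G -> R) : x \in U -> \sum_(v in U) unit_at x v * F v = F x.
Proof.
move=> xU; rewrite (bigD1 x) //= /unit_at eqxx mul1r big1 ?addr0 //.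
by move=> v /andP[_ /negPf ->]; rewrite mul0r.
Qed.

Lemma edge_form_bump g a x e : x \in U ->
  edge_form g (fun v => a v + e * unit_at x v) (fun v => a v + e * unit_at x v) =
  edge_form g a a + 2 * e * edge_row g a x.
Proof.
move=> xU; set b := (fun v => a v + e * unit_at x v).
have bE c : edge_form g c b = edge_form g c a + e * edge_form g c (unit_at x).
  by rewrite edge_formD edge_formZ.
rewrite bE (edge_formC g b a) (edge_formC g b (unit_at x)) !bE.
rewrite (edge_formC g a (unit_at x)) !edge_form_row !sum_unit_at //.
have -> : edge_row g (unit_at x) x = 0.
  rewrite /edge_row big1 // => u /andP[_ xu]; rewrite /unit_at.
  by have [ux|] := eqVneq u x; [rewrite ux adj_irrefl in xu | rewrite mulr0].
by ring.
Qed.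

Lemma weight_form_bump a x e : x \in U ->
  weight_form (fun v => a v + e * unit_at x v) =
  weight_form a + 2 * e * (turan_weight R U x * a x) + e ^+ 2 * turan_weight R U x.
Proof.
move=> xU; rewrite /weight_form (bigD1 x) //= [in RHS](bigD1 x) //=.
rewrite (eq_bigr (fun v => turan_weight R U v * a v ^+ 2)); last first.
  by move=> v /andP[_ /negPf vx]; rewrite /unit_at vx mulr0 addr0.
rewrite /unit_at eqxx /= !mulr1; ring.
Qed.

Definition rescale (c : G -> R) g : G -> J -> R := fun v j => c v * g v j.

Lemma gram_rescale c g u v : gram (rescale c g) u v = c u * c v * gram g u v.
Proof. by rewrite /gram mulr_sumr; apply: eq_bigr => j _; rewrite /rescale; ring. Qed.

Lemma edge_form_rescale c g a : edge_form (rescale c g) a a =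
  edge_form g (fun v => c v * a v) (fun v => c v * a v).
Proof.
by apply: eq_bigr => u _; apply: eq_bigr => v _; rewrite gram_rescale; ring.
Qed.

Lemma gram_norm_bump g x e : x \in U ->
  gram_norm (rescale (fun v => 1 + e * unit_at x v) g) =
  gram_norm g + 2 * (2 * e + e ^+ 2) * (\sum_(u in U) gram g x u ^+ 2)
   + (2 * e + e ^+ 2) ^+ 2 * gram g x x ^+ 2.
Proof.
move=> xU; set n := 2 * e + e ^+ 2.
have sq v : (1 + e * unit_at x v) ^+ 2 = 1 + n * unit_at x v.
  by rewrite /unit_at /n; case: (v == x); rewrite /= ?mulr1 ?mulr0; ring.
pose y v := n * unit_at x v.
have -> : gram_norm (rescale (fun v => 1 + e * unit_at x v) g) =
    \sum_(u in U) \sum_(v in U) (gram g u v ^+ 2 + y u * gram g u v ^+ 2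
      + y v * gram g u v ^+ 2 + y u * (y v * gram g u v ^+ 2)).
  apply: eq_bigr => u _; apply: eq_bigr => v _.
  by rewrite gram_rescale !exprMn !sq /y; ring.
under eq_bigr => u _ do rewrite !big_split /= -!mulr_sumr.
rewrite !big_split /= -/(gram_norm g).
have ys F : \sum_(v in U) y v * F v = n * F x.
  by rewrite /y -(sum_unit_at F xU) mulr_sumr; apply: eq_bigr => v _; rewrite mulrA.
under [X in _ + X + _]eq_bigr => u _ do rewrite (ys (fun v => gram g u v ^+ 2)).
under [X in _ + X]eq_bigr => u _ do rewrite (ys (fun v => gram g u v ^+ 2)).
rewrite !ys -mulr_sumr.
have -> : \sum_(u in U) gram g u x ^+ 2 = \sum_(u in U) gram g x u ^+ 2.
  by apply: eq_bigr => u _; rewrite gramC.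
by ring.
Qed.

(** The entrywise square of a Gram matrix is the Gram matrix of the tensor
    squares, here written in coordinates. *)
Lemma gram_sqr_form g (f f' : G -> R) :
  \sum_(v in U) f v * (\sum_(u in U) f' u * gram g v u ^+ 2) =
  \sum_(p : J * J) (\sum_(v in U) f v * (g v p.1 * g v p.2)) *
                   (\sum_(v in U) f' v * (g v p.1 * g v p.2)).
Proof.
under [RHS]eq_bigr => p _ do rewrite big_distrlr /=.
rewrite exchange_big; apply: eq_bigr => v _.
rewrite exchange_big mulr_sumr; apply: eq_bigr => u _.
rewrite expr2 /gram big_distrlr pair_big !mulr_sumr /=.
by apply: eq_bigr => p _; ring.
Qed.

Lemma gram_sqr_psd g (f : G -> R) : gram_norm g = 1 ->
  (\sum_(v in U) f v * (\sum_(u in U) gram g v u ^+ 2)) ^+ 2 <=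
  \sum_(v in U) f v * (\sum_(u in U) f u * gram g v u ^+ 2).
Proof.
move=> N1; have e v : \sum_(u in U) gram g v u ^+ 2 =
    \sum_(u in U) 1 * gram g v u ^+ 2.
  by apply: eq_bigr => u _; rewrite mul1r.
have B1 : \sum_(p : J * J) (\sum_(v in U) 1 * (g v p.1 * g v p.2)) ^+ 2 = 1.
  rewrite -[RHS]N1 /gram_norm.
  transitivity (\sum_(v in U) 1 * (\sum_(u in U) 1 * gram g v u ^+ 2)).
    by rewrite gram_sqr_form; apply: eq_bigr => p _; rewrite expr2.
  by apply: eq_bigr => v _; rewrite mul1r -e.
under eq_bigr => v _ do rewrite e.
rewrite !gram_sqr_form; apply: le_trans (cauchy_schwarz _ _ _) _.
rewrite B1 mulr1 le_eqVlt; apply/orP; left; apply/eqP.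
by apply: eq_bigr => p _; rewrite expr2.
Qed.

(** Moving a_v gives the row of the edge form at v; rescaling the v-th Gram vector
    changes the edge form as rescaling a_v does, but changes the norm through
    the row of squares at v.  Comparing the two yields the row sums of the
    squares.  The average (N + 1) / 2 bounds the square root of the squared norm
    N, with equality to first order at N = 1, and keeps the hypothesis
    polynomial. *)
Lemma stationary_of_maximum g a (s : R) : 1 <= s ->
  {in U, forall v, exists2 u, u \in U & adj v u} ->
  {in U, forall v, a v != 0} ->
  gram_norm g = 1 -> weight_form a = 1 -> edge_form g a a = s ->
  (forall g' a', edge_form g' a' a' <= s * ((gram_norm g' + 1) / 2) * weight_form a') ->
  stationary U (fun v => a v ^+ 2) (fun u v => gram g u v ^+ 2) /\
  {in U, forall v, s ^+ 2 * (turan_weight R U v ^+ 2 * a v ^+ 2) <=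
     degree U (fun v => a v ^+ 2) v * \sum_(u in U | adj v u) gram g v u ^+ 2}.
Proof.
move=> s1 noiso a0 N1 K1 Fs opt.
have rowE : {in U, forall v, edge_row g a v = s * (turan_weight R U v * a v)}.
  move=> v vU; apply/eqP; rewrite -subr_eq0; apply/eqP.
  apply: (@linear_le_square_eq0 _ _ (s * turan_weight R U v / 2)) => e _.
  have := opt g (fun u => a u + e * unit_at v u).
  rewrite edge_form_bump // weight_form_bump // N1 K1 Fs; lra.
have sumE : {in U, forall v, \sum_(u in U) gram g v u ^+ 2 = turan_weight R U v * a v ^+ 2}.
  move=> v vU; set S := \sum_(u in U) _.
  suff h : a v * edge_row g a v - s * S = 0.
    have s0 : s != 0 by rewrite gt_eqF //; lra.
    by apply: (mulfI s0); move: h; rewrite (rowE v vU); lra.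
  apply: (@linear_le_square_eq0 _ _ (s / 2 * (S + 9 / 2 * gram g v v ^+ 2))) => e e1.
  have := opt (rescale (fun u => 1 + e * unit_at v u) g) a.
  rewrite edge_form_rescale gram_norm_bump // N1 K1 -/S.
  have -> : edge_form g (fun u => (1 + e * unit_at v u) * a u) (fun u => (1 + e * unit_at v u) * a u)
     = edge_form g (fun u => a u + (e * a v) * unit_at v u) (fun u => a u + (e * a v) * unit_at v u).
    have eqf u : (1 + e * unit_at v u) * a u = a u + (e * a v) * unit_at v u.
      rewrite /unit_at; case: eqP => [->|_]; rewrite /= ?mulr1 ?mulr0; ring.
    by apply: eq_bigr => u _; apply: eq_bigr => x _; rewrite !eqf.
  rewrite edge_form_bump // Fs.
  have X0 := sqr_ge0 (gram g v v).
  (* the squared norm changes by a polynomial in (1 + e)^2 - 1 = 2 e + e^2 *)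
  have n9 : (2 * e + e ^+ 2) ^+ 2 <= 9 * e ^+ 2.
    have -> : (2 * e + e ^+ 2) ^+ 2 = (2 + e) ^+ 2 * e ^+ 2 by ring.
    rewrite ler_wpM2r ?sqr_ge0 //; move: e1; rewrite ler_norml => /andP[e1 e2]; nra.
  have := ler_wpM2r X0 n9; have e20 := sqr_ge0 e.
  move=> h1 h2.
  have h3 := ler_wpM2l (ltW (lt_le_trans ltr01 s1)) h1.
  lra.
have edgeE : {in U, forall v, s ^+ 2 * (turan_weight R U v ^+ 2 * a v ^+ 2) <=
     degree U (fun v => a v ^+ 2) v * \sum_(u in U | adj v u) gram g v u ^+ 2}.
  move=> v vU.
  have -> : s ^+ 2 * (turan_weight R U v ^+ 2 * a v ^+ 2) = edge_row g a v ^+ 2.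
    by rewrite rowE //; ring.
  rewrite mulrC; exact: cauchy_schwarz.
split=> //; split=> //.
- by move=> v vU; rewrite exprn_even_gt0 //= a0.
- by move=> u v; rewrite gramC.
- by move=> u v; apply: sqr_ge0.
- move=> f; apply: le_trans (gram_sqr_psd f N1).
  rewrite le_eqVlt (eq_bigr (fun v => f v * (\sum_(u in U) gram g v u ^+ 2))) ?eqxx //.
  by move=> v vU; rewrite sumE.
- move=> v vU; apply: le_trans (edgeE v vU).
  have s2 : 1 <= s ^+ 2 by apply: exprn_ege1.
  by apply: (ler_peMl _ s2); rewrite mulr_ge0 ?sqr_ge0.
Qed.
End Gram.

(** * Existence of maxima *)

Lemma continuous_bigsum (R : realType) (T : topologicalType) (I : Type) (s : seq I)
    (P : pred I) (f : I -> T -> R) :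
  (forall i, continuous (f i)) -> continuous (fun x => \sum_(i <- s | P i) f i x).
Proof.
move=> cf; elim: s => [|i s IHs].
  rewrite (_ : (fun _ => _) = fun=> 0); first by move=> x; apply: cst_continuous.
  by apply/funext => x; rewrite big_nil.
case Pi: (P i).
  rewrite (_ : (fun _ => _) = fun x => f i x + \sum_(j <- s | P j) f j x); last first.
    by apply/funext => x; rewrite big_cons Pi.
  by move=> x; apply: (@cvgD _ _ _ (nbhs x) _ (f i)); [apply: cf | apply: IHs].
rewrite (_ : (fun _ => _) = fun x => \sum_(j <- s | P j) f j x) //.
by apply/funext => x; rewrite big_cons Pi.
Qed.

Lemma continuous_mul (R : realType) (T : topologicalType) (f g : T -> R) :
  continuous f -> continuous g -> continuous (fun x => f x * g x).
Proof. by move=> cf cg x; apply: (@continuousM R T f g x (cf x) (cg x)). Qed.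

(** A continuous function attains its maximum on a compact subset of a cube; the
    bounds h1 and h2 stand for the two normalizations. *)
Lemma box_max (R : realType) (n : nat) (f h1 h2 : 'rV[R]_n -> R) (M : R) :
  0 <= M -> continuous f -> continuous h1 -> continuous h2 -> h1 0 <= 1 -> h2 0 <= 1 ->
  exists z, [/\ h1 z <= 1, h2 z <= 1 &
    forall z' : 'rV[R]_n, (forall i, `|z' ord0 i| <= M) -> h1 z' <= 1 -> h2 z' <= 1 -> f z' <= f z].
Proof.
move=> M0 cf c1 c2 h10 h20.
pose A := [set z : 'rV[R]_n | (forall i, `[- M, M]%classic (z ord0 i))]%classic.
pose B := (A `&` h1 @^-1` [set x | x <= 1] `&` h2 @^-1` [set x | x <= 1])%classic.
have cA : compact A.
  by apply: (@rV_compact R n (fun=> `[- M, M]%classic)) => i; apply: segment_compact.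
have cB : compact B.
  apply: compact_closedI; first apply: compact_closedI => //.
    by apply: preimage_closed => [x _|]; [apply: c1 | apply: closed_le].
  by apply: preimage_closed => [x _|]; [apply: c2 | apply: closed_le].
have [|z zB zmax] := EVT_max_rV _ cB (continuous_subspaceT cf).
  by exists 0; split=> //=; split=> //= i; rewrite mxE /= in_itv /= oppr_le0 M0.
exists z; have [[_ /= z1] /= z2] := set_mem zB; split=> // z' zM z1' z2'.
apply: zmax; apply: mem_set; split=> //=; split=> //= i.
by have := zM i; rewrite ler_norml /= in_itv.
Qed.

(** * The inequality for induced subgraphs *)

Lemma norm_le2 (R : realFieldType) (x : R) : x ^+ 2 <= 2 -> `|x| <= 2.
Proof.
move=> h; rewrite ler_norml; apply/andP.
by split; rewrite leNgt; apply/negP => h1; nra.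
Qed.

Section Bound.
Variables (R : realType) (G : sgraph) (J : finType).
Implicit Types (U : {set G}) (g : G -> J -> R) (a : G -> R).

Lemma gram_norm_ge0 U g : 0 <= gram_norm U g.
Proof. by apply: sumr_ge0 => u _; apply: sumr_ge0 => v _; apply: sqr_ge0. Qed.

Lemma weight_form_ge0 U a : 0 <= weight_form U a.
Proof.
by apply: sumr_ge0 => u uU; rewrite mulr_ge0 ?sqr_ge0 ?turan_weight_ge0.
Qed.

Lemma gram_norm_rescale U (c : R) g :
  gram_norm U (rescale (fun=> c) g) = c ^+ 4 * gram_norm U g.
Proof.
rewrite /gram_norm mulr_sumr; apply: eq_bigr => u _.
by rewrite mulr_sumr; apply: eq_bigr => v _; rewrite gram_rescale; ring.
Qed.

Lemma weight_form_scale U (c : R) a :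
  weight_form U (fun v => c * a v) = c ^+ 2 * weight_form U a.
Proof. by rewrite /weight_form mulr_sumr; apply: eq_bigr => u _; ring. Qed.

Lemma edge_form_scale U (c : R) g a :
  edge_form U g (fun v => c * a v) (fun v => c * a v) = c ^+ 2 * edge_form U g a a.
Proof. by rewrite edge_formZ edge_formC edge_formZ mulrA -expr2. Qed.

(** The edge form is linear in the Gram matrix, so a bound under the
    normalization extends by scaling the Gram vectors by the fourth root of the
    squared norm. *)
Lemma edge_form_homogeneous U (s : R) : 0 <= s ->
  (forall g a, gram_norm U g <= 1 -> edge_form U g a a <= s * weight_form U a) ->
  forall g a, edge_form U g a a <= s * ((gram_norm U g + 1) / 2) * weight_form U a.
Proof.
move=> s0 h g a; have N0 := gram_norm_ge0 U g; have K0 := weight_form_ge0 U a.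
have [N1|N1] := leP (gram_norm U g) 0.
  have Nz : gram_norm U g = 0 by lra.
  have := h (rescale (fun=> 2) g) a; rewrite gram_norm_rescale Nz mulr0 ler01.
  move=> /(_ isT); rewrite edge_form_rescale edge_form_scale => h1.
  have := mulr_ge0 s0 K0; lra.
pose t := Num.sqrt (gram_norm U g); have t0 : 0 < t by rewrite sqrtr_gt0.
have tt : t ^+ 2 = gram_norm U g by rewrite sqr_sqrtr.
pose c := Num.sqrt t; have c0 : 0 < c by rewrite sqrtr_gt0.
have cc : c ^+ 2 = t by rewrite sqr_sqrtr // ltW.
have e : gram_norm U (rescale (fun=> c^-1) g) = 1.
  rewrite gram_norm_rescale -tt -cc -exprM exprVn mulVf // expf_neq0 //.
  by rewrite gt_eqF.
have := h (rescale (fun=> c^-1) g) a; rewrite e lexx => /(_ isT).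
rewrite edge_form_rescale edge_form_scale exprVn cc.
rewrite ler_pdivrMl // => /le_trans; apply.
rewrite mulrA ler_wpM2r // mulrC ler_wpM2l // -tt.
have := sqr_ge0 (t - 1); rewrite sqrrB1; lra.
Qed.

Lemma turan_weight_mono U U' v : U' \subset U -> v \in U' ->
  turan_weight R U' v <= turan_weight R U v.
Proof.
move=> s vU'; have vU := subsetP s v vU'.
have c0 := clique_number_in_gt0 vU; have c0' := clique_number_in_gt0 vU'.
rewrite lerD2l lerN2 lef_pV2 ?posrE ?ltr0n //.
by rewrite ler_nat clique_number_in_mono.
Qed.

Lemma weight_form_mono U x a : weight_form (U :\ x) a <= weight_form U a.
Proof.
rewrite /weight_form [leRHS](big_setID (U :\ x)) /= (setIidPr (subsetDl _ _)).
rewrite -[leLHS]addr0 lerD //.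
  apply: ler_sum => v vU; rewrite ler_wpM2r ?sqr_ge0 //.
  by apply: turan_weight_mono => //; apply: subsetDl.
apply: sumr_ge0 => v; rewrite inE => /andP[_ vU].
by rewrite mulr_ge0 ?sqr_ge0 ?turan_weight_ge0.
Qed.

Lemma gram_normS U U' g : U' \subset U -> gram_norm U' g <= gram_norm U g.
Proof.
move=> /setIidPr UI; have le1 (F : G -> R) : (forall v, 0 <= F v) ->
    \sum_(v in U') F v <= \sum_(v in U) F v.
  by move=> F0; rewrite [leRHS](big_setID U') /= UI lerDl sumr_ge0.
apply: le_trans (le1 _ _) => [|v]; last by apply: sumr_ge0 => u _; apply: sqr_ge0.
by apply: ler_sum => u _; apply: le1 => v; apply: sqr_ge0.
Qed.

Lemma edge_form_remove U x g a : x \in U ->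
  {in U, forall u, adj x u -> a x * a u = 0} ->
  edge_form U g a a = edge_form (U :\ x) g a a.
Proof.
move=> xU h; rewrite /edge_form (big_setD1 x xU) /= big1 ?add0r; last first.
  by move=> u /andP[uU xu]; rewrite h // mulr0.
apply: eq_bigr => u; rewrite !inE => /andP[_ uU].
have [ux|nux] := boolP (adj u x); last first.
  apply: eq_bigl => v; rewrite !inE.
  have [->|//] := eqVneq v x; first by rewrite (negPf nux) !andbF.
rewrite (bigD1 x) ?xU //= [a u * _]mulrC h // 1?adj_sym // mulr0 add0r.
by apply: eq_bigl => v; rewrite !inE; case: (v == x); rewrite /= ?andbF ?andbT.
Qed.

Lemma edge_form_eq0 U g a : {in U, forall v, a v = 0} -> edge_form U g a a = 0.
Proof.
move=> a0; apply: big1 => u uU; apply: big1 => v _.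
by rewrite (a0 u uU) mul0r mulr0.
Qed.

(** Without isolated vertices every weight is at least 1/2, so the normalization
    confines a, as well as the Gram vectors, to a cube.  Scaling a turns the
    maximum on the normalized set into a bound for all a. *)
Lemma edge_form_maximum U :
  {in U, forall v, exists2 u, u \in U & adj v u} ->
  exists g, exists a, [/\ gram_norm U g <= 1, weight_form U a <= 1 &
    forall g' a', gram_norm U g' <= 1 ->
      edge_form U g' a' a' <= edge_form U g a a * weight_form U a'].
Proof.
move=> noiso.
have khalf v : v \in U -> 2^-1 <= turan_weight R U v.
  by move=> vU; have [u uU vu] := noiso v vU; apply/turan_weight_ge_half/(clique_number_in_gt1 vU uU).
pose gz (z : 'rV[R]_#|{: G * J + G}|) u j := z ord0 (enum_rank (inl (u, j))).
pose az (z : 'rV[R]_#|{: G * J + G}|) u := z ord0 (enum_rank (inr u)).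
have cz i : continuous (fun z : 'rV[R]_#|{: G * J + G}| => z ord0 i).
  by move=> z; apply: coord_continuous.
have cgram u v : continuous (fun z => gram (gz z) u v).
  by apply: continuous_bigsum => j; apply: continuous_mul; apply: cz.
have c1 : continuous (fun z => gram_norm U (gz z)).
  apply: continuous_bigsum => u; apply: continuous_bigsum => v.
  by apply: continuous_mul; apply: cgram.
have c2 : continuous (fun z => weight_form U (az z)).
  apply: continuous_bigsum => u; apply: continuous_mul.
    by move=> z; apply: cst_continuous.
  by apply: continuous_mul; apply: cz.
have c3 : continuous (fun z => edge_form U (gz z) (az z) (az z)).
  apply: continuous_bigsum => u; apply: continuous_bigsum => v.
  by apply: continuous_mul; [apply: cgram | apply: continuous_mul; apply: cz].
have z1 : gram_norm U (gz 0) <= 1.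
  rewrite /gram_norm big1 ?ler01 // => u _; rewrite big1 // => v _.
  by rewrite /gram big1 ?expr0n // => j _; rewrite /gz mxE mul0r.
have z2 : weight_form U (az 0) <= 1.
  by rewrite /weight_form big1 ?ler01 // => u _; rewrite /az mxE expr0n mulr0.
have [z [h1 h2 zmax]] := box_max (ler0n R 2) c3 c1 c2 z1 z2.
exists (gz z), (az z); split=> // g' a' N1.
have [K0|K0] := leP (weight_form U a') 0.
  have a0 : {in U, forall v, a' v = 0}.
    move=> v vU; have /eqP : weight_form U a' = 0 by have := weight_form_ge0 U a'; lra.
    rewrite psumr_eq0 => [|u uU]; last by rewrite mulr_ge0 ?sqr_ge0 ?turan_weight_ge0.
    move/allP/(_ v (mem_index_enum _)); rewrite vU /= mulf_eq0 sqrf_eq0.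
    by case/orP => /eqP // k0; have := khalf v vU; rewrite k0; lra.
  rewrite edge_form_eq0 //; have -> : weight_form U a' = 0 by have := weight_form_ge0 U a'; lra.
  by rewrite mulr0.
pose t := Num.sqrt (weight_form U a').
have t0 : 0 < t by rewrite sqrtr_gt0.
have tt : t ^+ 2 = weight_form U a' by rewrite sqr_sqrtr // ltW.
pose a'' v := t^-1 * a' v.
(* vanishing outside U keeps z' in the cube without changing the forms *)
pose z' : 'rV[R]_#|{: G * J + G}| := \row_i match enum_val i with
  | inl (u, j) => if u \in U then g' u j else 0
  | inr u => if u \in U then a'' u else 0 end.
have gE u j : u \in U -> gz z' u j = g' u j.
  by move=> uU; rewrite /gz mxE enum_rankK uU.
have aE u : u \in U -> az z' u = a'' u.
  by move=> uU; rewrite /az mxE enum_rankK uU.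
have gramE u v : u \in U -> v \in U -> gram (gz z') u v = gram g' u v.
  by move=> uU vU; apply: eq_bigr => j _; rewrite !gE.
have NE : gram_norm U (gz z') = gram_norm U g'.
  by apply: eq_bigr => u uU; apply: eq_bigr => v vU; rewrite gramE.
have KE : weight_form U (az z') = 1.
  transitivity (weight_form U a''); first by apply: eq_bigr => u uU; rewrite aE.
  by rewrite weight_form_scale exprVn tt mulVf ?gt_eqF.
have FE : edge_form U (gz z') (az z') (az z') = t ^- 2 * edge_form U g' a' a'.
  transitivity (edge_form U g' a'' a''); last by rewrite edge_form_scale exprVn.
  by apply: eq_bigr => u uU; apply: eq_bigr => v /andP[vU _]; rewrite gramE // !aE.
have := zmax z'; rewrite NE KE N1 lexx FE tt ler_pdivrMl // mulrC.
apply=> // i; rewrite mxE; case: (enum_val i) => [[u j]|u]; case: ifP => uU; rewrite ?normr0 //.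
  apply: norm_le2; have s1 : gram g' u u <= 1.
    rewrite -(ler_pXn2r (n := 2)) ?nnegrE ?ler01 ?sumr_ge0 // => [|j' _]; last first.
      by rewrite -expr2 sqr_ge0.
    rewrite expr1n; apply: le_trans N1; rewrite /gram_norm (bigD1 u) //=.
    rewrite (bigD1 u) //= -addrA lerDl addr_ge0 //.
      by apply: sumr_ge0 => v _; apply: sqr_ge0.
    by apply: sumr_ge0 => v _; apply: sumr_ge0 => w _; apply: sqr_ge0.
  have : g' u j ^+ 2 <= gram g' u u.
    rewrite /gram (bigD1 j) //= expr2 lerDl; apply: sumr_ge0 => j' _.
    by rewrite -expr2 sqr_ge0.
  by lra.
apply: norm_le2.
have : turan_weight R U u * a'' u ^+ 2 <= 1.
  have <- : weight_form U a'' = 1 by rewrite weight_form_scale exprVn tt mulVf ?gt_eqF.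
  rewrite /weight_form (bigD1 u) //= lerDl; apply: sumr_ge0 => v /andP[vU _].
  by rewrite mulr_ge0 ?sqr_ge0 ?turan_weight_ge0.
by have := ler_wpM2r (sqr_ge0 (a'' u)) (khalf u uU); lra.
Qed.

End Bound.

(** Induction on the order of U.  A vertex that is isolated, or at which the
    maximizing vector vanishes, contributes nothing and can be removed, which
    only lowers the weights.  Otherwise a maximal value s > 1 would be
    stationary, and then [stationary_structure] turns the row bound, which
    carries a factor s ^+ 2, into s ^+ 2 <= 1. *)
Lemma edge_form_le (R : realType) (G : sgraph) (J : finType) (U : {set G})
    (g : G -> J -> R) (a : G -> R) :
  gram_norm U g <= 1 -> edge_form U g a a <= weight_form U a.
Proof.
elim: {U}#|U| {-2}U (leqnn #|U|) g a => [|n IHn] U cardU g a N1.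
  move: cardU; rewrite leqn0 cards_eq0 => /eqP ->.
  by rewrite /edge_form /weight_form !big_set0.
have remove x (g' : G -> J -> R) (a' : G -> R) : x \in U -> {in U, forall u, adj x u -> a' x * a' u = 0} ->
    gram_norm U g' <= 1 -> edge_form U g' a' a' <= weight_form U a'.
  move=> xU h N1'; rewrite (edge_form_remove _ xU h).
  apply: le_trans (weight_form_mono _ _ _); apply: IHn.
    by move: cardU; rewrite (cardsD1 x) xU.
  exact: le_trans (gram_normS _ (subsetDl _ _)) N1'.
have [[x xU xiso]|noiso0] := pselect (exists2 x, x \in U & {in U, forall u, ~~ adj x u}).
  by apply: (remove x) => // u uU; rewrite (negPf (xiso u uU)).
have noiso : {in U, forall v, exists2 u, u \in U & adj v u}.
  move=> v vU; have [/exists_inP[u uU vu]|] := boolP [exists u in U, adj v u].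
    by exists u.
  rewrite negb_exists_in => /forall_inP h; exfalso; apply: noiso0.
  by exists v.
have [U0|U0] := eqVneq U set0.
  by rewrite U0 /edge_form /weight_form !big_set0.
have [g1 [a1 [Ng Ka opt]]] := edge_form_maximum R J noiso.
set s := edge_form U g1 a1 a1 in opt.
suff s1 : s <= 1.
  apply: le_trans (opt g a N1) _.
  by rewrite -[leRHS]mul1r ler_wpM2r ?weight_form_ge0.
rewrite leNgt; apply/negP => s1.
have s0 : 0 <= s by lra.
have hom := edge_form_homogeneous s0 opt.
have K1 : weight_form U a1 = 1.
  apply/eqP; rewrite eq_le Ka /=; have := opt g1 a1 Ng.
  by rewrite -/s -{1}[s]mulr1 ler_pM2l //; lra.
have N1' : gram_norm U g1 = 1.
  apply/eqP; rewrite eq_le Ng /=; have := hom g1 a1.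
  rewrite -/s K1 mulr1 -{1}[s]mulr1 ler_pM2l; lra.
have a10 : {in U, forall v, a1 v != 0}.
  move=> v vU; apply/eqP => a1v.
  have h : {in U, forall u, adj v u -> a1 v * a1 u = 0}.
    by move=> u _ _; rewrite a1v mul0r.
  by have := remove v g1 a1 vU h Ng; rewrite -/s K1 leNgt s1.
have [st tight] := stationary_of_maximum (ltW s1) noiso a10 N1' K1 erefl hom.
have [Q [p [_ _ _ _ eq]]] := stationary_structure st U0.
have /set0Pn[v vU] := U0.
have k0 : 0 < turan_weight R U v ^+ 2 * a1 v ^+ 2.
  rewrite mulr_gt0 ?exprn_even_gt0 ?a10 //=.
  by rewrite gt_eqF // (turan_weight_gt0 st).
have := tight v vU; rewrite eq // ger_pMl //.
by apply/negP; rewrite -ltNge exprn_egt1.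
Qed.

(** * The positive part of the adjacency matrix *)

Lemma char_poly_conj (F : fieldType) n (P D : 'M[F]_n) : P \in unitmx ->
  char_poly (invmx P *m D *m P) = char_poly D.
Proof.
move=> uP; have uP' : map_mx polyC (invmx P) *m map_mx polyC P = 1%:M.
  by rewrite -map_mxM mulVmx // map_mx1.
rewrite /char_poly /char_poly_mx.
have -> : 'X%:M - map_mx polyC (invmx P *m D *m P) =
    map_mx polyC (invmx P) *m ('X%:M - map_mx polyC D) *m map_mx polyC P.
  rewrite mulmxBr mulmxBl !map_mxM; congr (_ - _).
  by rewrite scalar_mxC -mulmxA uP' mulmx1.
by rewrite !det_mulmx mulrAC -det_mulmx uP' det1 mul1r.
Qed.

Section ComplexParts.
Variable R : realType.
Implicit Types x y : R[i].

Lemma Re_mul x y : complex.Re (x * y) =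
  complex.Re x * complex.Re y - complex.Im x * complex.Im y.
Proof. by case: x y => [a b] [c d]. Qed.

Lemma Im_mul x y : complex.Im (x * y) =
  complex.Re x * complex.Im y + complex.Im x * complex.Re y.
Proof. by case: x y => [a b] [c d]. Qed.

Lemma Re_conj x : complex.Re (Num.conj x) = complex.Re x.
Proof. by case: x. Qed.

Lemma Im_conj x : complex.Im (Num.conj x) = - complex.Im x.
Proof. by case: x. Qed.

End ComplexParts.

(** The spectral theorem over R[i], with the spectrum identified with the list of
    roots of the characteristic polynomial. *)
Lemma symmetric_spectrum (R : realType) (n : nat) (A : 'M[R]_n) : A^T = A ->
  exists lam : 'I_n -> R, exists P : 'M[R[i]]_n,
  [/\ P \in unitmx, invmx P = map_mx Num.conj P^T,
      perm_eq (eigenvalues A) [seq lam i | i <- enum 'I_n] &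
      map_mx (real_complex R) A =
        invmx P *m diag_mx (\row_i real_complex R (lam i)) *m P].
Proof.
move=> symA; pose c := real_complex R; pose B := map_mx c A.
have hermB : B \is hermsymmx.
  apply/is_hermitianmxP; rewrite expr0 scale1r.
  by apply/matrixP=> i j; rewrite !mxE -{1}symA mxE /c conj_Creal ?complex_real.
have /orthomx_spectralP BE := hermitian_normalmx hermB.
pose P := spectralmx B; have uP : P \in unitmx by apply: spectral_unit.
pose lam i := complex.Re (spectral_diag B 0 i).
have lamE i : spectral_diag B 0 i = c (lam i).
  have /mxOverP /(_ 0 i) h := hermitian_spectral_diag_real hermB.
  by rewrite /c RRe_real.
have BE' : B = invmx P *m diag_mx (\row_i c (lam i)) *m P.
  rewrite {1}BE; congr (_ *m diag_mx _ *m _).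
  by apply/rowP => i; rewrite !mxE lamE.
exists lam, P; split=> //.
  by rewrite invmx_unitary ?spectral_unitarymx.
have cinj : injective c by move=> x y [].
suff : perm_eq (map c (eigenvalues A)) (map c [seq lam i | i <- enum 'I_n]).
  by move/(perm_map (@complex.Re R)); rewrite -!map_comp !map_id.
apply: prod_XsubC_eq; rewrite big_map [RHS]big_map [RHS]big_map big_enum /=.
have -> : \prod_(x <- eigenvalues A) ('X - (c x)%:P) = map_poly c (char_poly A).
  rewrite char_poly_eigenvalues // rmorph_prod /=; apply: eq_bigr => x _.
  by rewrite map_polyXsubC.
rewrite map_char_poly -/B BE' char_poly_conj // char_poly_trig ?diag_mx_is_trig //.
by apply: eq_bigr => i _; rewrite !mxE eqxx mulr1n.
Qed.

(** The Gram matrix is the real part of the complex matrix Z that is the positive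
    part of the adjacency matrix.  Real and imaginary parts of eigenvectors
    provide the Gram vectors, whence the index type [bool * 'I_#|G|].  The trace
    of A Z is the energy because A is real; the trace of Z Z is also the energy,
    and taking the real part of Z can only decrease the norm. *)
Lemma energy_gram (R : realType) (G : sgraph) :
  let E := positive_square_energy R G in
  exists g : G -> bool * 'I_#|G| -> R,
    edge_form [set: G] g (fun=> 1) (fun=> 1) = E /\ gram_norm [set: G] g <= E.
Proof.
move=> E; pose A := adjacency R G.
have symA : A^T = A by apply/matrixP => i j; rewrite !mxE adj_sym.
have [lam [P [uP PE perm BE]]] := symmetric_spectrum symA.
pose c := real_complex R; pose B := map_mx c A.
(* eigenvalues of the positive part *)
pose mu i := Num.max (lam i) 0.
have mu0 i : 0 <= mu i by rewrite le_max lexx orbT.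
have EE : E = \sum_i mu i ^+ 2.
  rewrite /E /positive_square_energy (perm_big _ perm) big_map big_enum_cond /=.
  rewrite big_mkcond; apply: eq_bigr => i _; rewrite /mu maxEle.
  by case: ltP => // _; rewrite expr0n.
pose Z := invmx P *m diag_mx (\row_i c (mu i)) *m P.
have ZE u v : Z u v = \sum_i Num.conj (P i u) * c (mu i) * P i v.
  rewrite /Z PE mxE; apply: eq_bigr => i _; rewrite mxE (bigD1 i) //= big1.
    by rewrite !mxE eqxx mulr1n addr0.
  by move=> j ji; rewrite !mxE (negPf ji) mulr0n mulr0.
pose g u (p : bool * 'I_#|G|) : R := Num.sqrt (mu p.2) *
  (if p.1 then complex.Re (P p.2 (enum_rank u)) else complex.Im (P p.2 (enum_rank u))).
have ReZ u v : complex.Re (Z (enum_rank u) (enum_rank v)) = gram g u v.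
  rewrite ZE raddf_sum /gram -(pair_bigA _ (fun b i => g u (b, i) * g v (b, i))) /=.
  rewrite exchange_big; apply: eq_bigr => i _; rewrite big_bool /g /=.
  rewrite !Re_mul !Im_mul Re_conj Im_conj /c /=.
  have sq : mu i = Num.sqrt (mu i) * Num.sqrt (mu i) by rewrite -expr2 sqr_sqrtr.
  by move: (Num.sqrt (mu i)) sq => q ->; ring.
have ImE u v : complex.Im (Z u v) = \sum_i mu i *
    (complex.Re (P i u) * complex.Im (P i v) - complex.Im (P i u) * complex.Re (P i v)).
  rewrite ZE raddf_sum /=; apply: eq_bigr => i _.
  by rewrite !Im_mul !Re_mul !Re_conj !Im_conj /c /=; ring.
have ImZ u v : complex.Im (Z u v) = - complex.Im (Z v u).
  by rewrite !ImE -sumrN; apply: eq_bigr => i _; ring.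
have ReZC u v : complex.Re (Z u v) = complex.Re (Z v u).
  rewrite !ZE !raddf_sum /=; apply: eq_bigr => i _.
  by rewrite !Re_mul !Im_mul !Re_conj !Im_conj /c /=; ring.
have trM (x : 'rV[R]_#|G|) : \tr (invmx P *m diag_mx (\row_i c (x 0 i)) *m P *m Z) =
    c (\sum_i x 0 i * mu i).
  rewrite /Z !mulmxA mulmxK // mxtrace_mulC !mulmxA mulmxV // mul1mx.
  rewrite mulmx_diag mxtrace_diag /c rmorph_sum; apply: eq_bigr => i _.
  by rewrite !mxE rmorphM.
have traceE (X : 'M[R[i]]_#|G|) : complex.Re (\tr (X *m Z)) =
    \sum_u \sum_v complex.Re (X (enum_rank u) (enum_rank v) * Z (enum_rank v) (enum_rank u)).
  rewrite /mxtrace raddf_sum /= (reindex (@enum_rank G)) /=; last first.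
    by apply: onW_bij; apply: enum_rank_bij.
  apply: eq_bigr => u _; rewrite mxE raddf_sum /= (reindex (@enum_rank G)) //=.
  by apply: onW_bij; apply: enum_rank_bij.
exists g; split.
  have : complex.Re (\tr (B *m Z)) = E.
    have -> : B = invmx P *m diag_mx (\row_i c ((\row_j lam j) 0 i)) *m P.
      by rewrite /B BE; congr (_ *m diag_mx _ *m _); apply/rowP => i; rewrite !mxE.
    rewrite trM /= EE; apply: eq_bigr => i _; rewrite mxE /mu maxEle.
    by case: ltP => _; rewrite expr2 ?mulr0.
  rewrite traceE => <-; rewrite /edge_form; apply: eq_big => [u|u _]; first by rewrite inE.
  rewrite big_mkcond; apply: eq_bigr => v _; rewrite in_setT /= Re_mul ReZ !mxE !enum_rankK /=.
  by rewrite mul0r subr0 [gram g v u]gramC; case: (adj u v); rewrite /= ?mul1r ?mulr1 ?mul0r.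
have <- : complex.Re (\tr (Z *m Z)) = E.
  have -> : Z *m Z = invmx P *m diag_mx (\row_i c ((\row_j mu j) 0 i)) *m P *m Z.
    by congr (_ *m _); rewrite /Z; congr (_ *m diag_mx _ *m _); apply/rowP => i; rewrite !mxE.
  by rewrite trM /= EE; apply: eq_bigr => i _; rewrite mxE expr2.
rewrite traceE /gram_norm; rewrite (eq_bigl predT) => [|u]; last by rewrite inE.
apply: ler_sum => u _; rewrite (eq_bigl predT) => [|v]; last by rewrite inE.
apply: ler_sum => v _; rewrite Re_mul [complex.Re (Z (enum_rank v) _)]ReZC.
rewrite [complex.Im (Z (enum_rank v) _)]ImZ ReZ mulrN opprK -!expr2 lerDl.
exact: sqr_ge0.
Qed.

(** * The energy bound and its case of equality *)

Section Energy.
Variables (R : realType) (G : sgraph).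

Lemma energy_ge0 : 0 <= positive_square_energy R G.
Proof. by apply: sumr_ge0 => x _; apply: sqr_ge0. Qed.

Lemma normalized_energy_gram : 0 < positive_square_energy R G ->
  exists g : G -> bool * 'I_#|G| -> R,
    edge_form [set: G] g (fun=> 1) (fun=> 1) = Num.sqrt (positive_square_energy R G)
    /\ gram_norm [set: G] g <= 1.
Proof.
set E := positive_square_energy R G => E0; have [g [Fg Ng]] := energy_gram R G.
pose t := Num.sqrt E; have t0 : 0 < t by rewrite sqrtr_gt0.
have tt : t ^+ 2 = E by rewrite sqr_sqrtr // ltW.
pose c := Num.sqrt t; have c0 : 0 < c by rewrite sqrtr_gt0.
have cc : c ^+ 2 = t by rewrite sqr_sqrtr // ltW.
exists (rescale (fun=> c^-1) g); split.
  rewrite edge_form_rescale edge_form_scale Fg exprVn cc -/t -/E -tt expr2.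
  by rewrite mulKf // gt_eqF.
rewrite gram_norm_rescale (_ : 4%N = (2 * 2)%N) // exprM exprVn cc exprVn tt.
by rewrite ler_pdivrMl // mulr1.
Qed.

Lemma weight_form1 :
  weight_form [set: G] (fun=> 1) = \sum_(v : G) (1 - (local_clique_number v)%:R^-1) :> R.
Proof.
apply: eq_big => [v|v _]; first by rewrite inE.
by rewrite expr1n mulr1 /turan_weight clique_number_in_setT.
Qed.

Lemma sqrt_energy_le : Num.sqrt (positive_square_energy R G) <=
  \sum_(v : G) (1 - (local_clique_number v)%:R^-1).
Proof.
rewrite -weight_form1; have [E0|E0] := leP (positive_square_energy R G) 0.
  by rewrite ler0_sqrtr // weight_form_ge0.
by have [g [<- N1]] := normalized_energy_gram E0; apply: edge_form_le.
Qed.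

Lemma local_clique_number_isolated (v : G) :
  (forall u, ~~ adj v u) -> local_clique_number v = 1%N.
Proof.
move=> iso; apply/eqP; rewrite eqn_leq -clique_number_in_setT.
rewrite clique_number_in_gt0 ?inE // andbT.
apply/bigmax_leqP => Q /and3P[vQ _ /cliqueP cQ].
rewrite -(cards1 v) subset_leq_card //; apply/subsetP => u uQ; rewrite inE.
by apply: contraT => uv; have := cQ v u vQ uQ; rewrite eq_sym uv (negPf (iso u)) => /(_ isT).
Qed.

Definition nonisolated : {set G} := [set v | [exists u, adj v u]].

Lemma nonisolatedP v : reflect (exists u, adj v u) (v \in nonisolated).
Proof. by rewrite inE; apply: existsP. Qed.

Lemma notin_nonisolated v u : v \notin nonisolated -> ~~ adj v u.
Proof. by apply: contra => vu; apply/nonisolatedP; exists u. Qed.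

Lemma clique_number_in_nonisolated v : v \in nonisolated ->
  clique_number_in nonisolated v = local_clique_number v.
Proof.
move=> vU; apply: eq_bigl => Q; case vQ: (v \in Q) => //=.
case cQ: (clique Q); rewrite ?andbF // andbT; apply/subsetP => u uQ.
have [->//|uv] := eqVneq u v.
by apply/nonisolatedP; exists v; apply: (cliqueP _ cQ).
Qed.

Lemma weight_form_nonisolated : weight_form nonisolated (fun=> 1) =
  \sum_(v : G) (1 - (local_clique_number v)%:R^-1) :> R.
Proof.
rewrite [RHS](bigID (mem nonisolated)) /= [X in _ + X]big1 ?addr0.
  by apply: eq_bigr => v vU; rewrite expr1n mulr1 /turan_weight clique_number_in_nonisolated.
move=> v vU; rewrite local_clique_number_isolated ?invr1 ?subrr // => u.
exact: notin_nonisolated.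
Qed.

Lemma edge_form_nonisolated (J : finType) (g : G -> J -> R) a :
  edge_form [set: G] g a a = edge_form nonisolated g a a.
Proof.
rewrite /edge_form (big_setID nonisolated) /= setTI [X in _ + X]big1 ?addr0.
  apply: eq_bigr => u uU; apply: eq_bigl => v; rewrite inE.
  case uv: (adj u v); rewrite ?andbF // !andbT; apply/esym/nonisolatedP.
  by exists u; rewrite adj_sym.
move=> u; rewrite inE => /andP[uU _]; apply: big1 => v /andP[_ uv].
by have := notin_nonisolated v uU; rewrite uv.
Qed.

(** Equality makes the constant vector and the normalized positive part of the
    adjacency matrix a maximum of the edge form, so they are stationary.
    Constant weights turn cells of equal weight into cells of equal
    cardinality. *)
Lemma equality_structure : ~ edgeless G ->
  Num.sqrt (positive_square_energy R G) =
    \sum_(v : G) (1 - (local_clique_number v)%:R^-1) ->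
  exists Q : {set G}, exists p : G -> G, exists t : nat,
  [/\ (1 < #|Q|)%N, (0 < t)%N, {in nonisolated, forall x, p x \in Q},
      {in nonisolated &, forall x y, adj x y = (p x != p y)} &
      {in Q, forall q, #|[set x in nonisolated | p x == q]| = t}].
Proof.
move=> edge eq; set U := nonisolated; set K := \sum_(v : G) _ in eq.
have U0 : U != set0.
  apply/eqP => Ue; apply: edge => u v; apply: contraT => /negPn uv.
  have : u \in U by apply/nonisolatedP; exists v.
  by rewrite Ue inE.
have noiso : {in U, forall v, exists2 u, u \in U & adj v u}.
  move=> v /nonisolatedP[u vu]; exists u => //; apply/nonisolatedP; exists v.
  by rewrite adj_sym.
have K0 : 0 < K.
  rewrite /K -weight_form_nonisolated; have /set0Pn[v vU] := U0.
  rewrite /weight_form (bigD1 v) //= expr1n mulr1 ltr_wpDr //.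
    by apply: sumr_ge0 => u /andP[uU _]; rewrite mulr1 turan_weight_ge0.
  have [u uU vu] := noiso v vU.
  have := turan_weight_ge_half R (clique_number_in_gt1 vU uU vu); lra.
have E0 : 0 < positive_square_energy R G.
  by rewrite -sqrtr_gt0 eq.
have [g [Fg Ng]] := normalized_energy_gram E0.
have opt := edge_form_homogeneous (U := U) ler01
  (fun (g : G -> bool * 'I_#|G| -> R) a N1 =>
     eq_ind_r (fun x => _ <= x) (edge_form_le a N1) (mul1r (weight_form U a))).
pose c : R := (Num.sqrt K)^-1.
have cc : c ^+ 2 = K^-1 by rewrite exprVn sqr_sqrtr // ltW.
have c0 : c != 0 by rewrite invr_eq0 gt_eqF // sqrtr_gt0.
have W1 : weight_form U (fun=> 1) = K := weight_form_nonisolated.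
have Wc : weight_form U (fun=> c) = 1.
  transitivity (weight_form U (fun=> c * 1)); first by rewrite mulr1.
  by rewrite weight_form_scale W1 cc mulVf // gt_eqF.
have FU : edge_form U g (fun=> 1) (fun=> 1) = K by rewrite -edge_form_nonisolated Fg.
have Fc : edge_form U g (fun=> c) (fun=> c) = 1.
  transitivity (edge_form U g (fun=> c * 1) (fun=> c * 1)); first by rewrite mulr1.
  by rewrite edge_form_scale FU cc mulVf // gt_eqF.
have N1 : gram_norm U g = 1.
  apply/eqP; rewrite eq_le (le_trans (gram_normS g (subsetT U)) Ng) /=.
  by have := opt g (fun=> c); rewrite Fc Wc; lra.
have [st _] := stationary_of_maximum (lexx 1) noiso (fun v _ => c0) N1 Wc Fc opt.
have [Q [p [Q1 pQ padj pw _]]] := stationary_structure st U0.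
have size q : q \in Q -> #|[set x in U | p x == q]|%:R * c ^+ 2 = (#|Q|%:R - 1)^-1.
  move=> qQ; rewrite -(pw q qQ) sumr_const -[RHS]mulr_natl; congr (_%:R * _).
  by apply: eq_card => x; rewrite inE.
have /card_gt0P[q0 q0Q] : (0 < #|Q|)%N by lia.
have c20 : c ^+ 2 != 0 by rewrite expf_neq0.
exists Q, p, #|[set x in U | p x == q0]|; split=> //.
- rewrite -(ltr0n R) -(pmulr_lgt0 _ (_ : 0 < c ^+ 2)) ?size //.
    by rewrite invr_gt0 subr_gt0 ltr1n.
  by rewrite exprn_even_gt0 //= c0.
- move=> q qQ; apply/eqP; rewrite -(eqr_nat R); apply/eqP/(mulIf c20).
  by rewrite !size.
Qed.

End Energy.

(** * Balanced complete multipartite graphs *)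

Definition balanced (r t q : nat) : sgraph :=
  disjoint_union (complete_multipartite (fun _ : 'I_r => t)) (isolated_vertices q).

Lemma card_balanced (r t q : nat) : #|balanced r t q| = (r * t + q)%N.
Proof.
rewrite card_sum card_ord; congr (_ + _)%N; rewrite card_tagged sumnE big_map big_enum /=.
by rewrite (eq_bigr (fun=> t)) ?sum_nat_const ?card_ord // => i _; rewrite card_ord.
Qed.

(** A vertex x goes to the part numbered by p x, at the position of x in its
    class; vertices without neighbours are numbered separately. *)
Lemma isomorphic_balanced (G : sgraph) (Q : {set G}) (p : G -> G) (t : nat) :
  (0 < #|Q|)%N -> (0 < t)%N -> {in nonisolated G, forall x, p x \in Q} ->
  {in nonisolated G &, forall x y, adj x y = (p x != p y)} ->
  {in Q, forall q, #|[set x in nonisolated G | p x == q]| = t} ->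
  isomorphic G (balanced #|Q| t #|~: nonisolated G|).
Proof.
set U := nonisolated G => /card_gt0P[q0 q0Q] + pQ padj.
case: t => // t _ pt.
pose cls x := [set y in U | p y == p x].
pose part x : 'I_#|Q| := enum_rank_in q0Q (p x).
pose pos x : 'I_t.+1 := inord (index x (enum (cls x))).
pose f (x : G) : balanced #|Q| t.+1 #|~: U| :=
  match @idP (x \in ~: U) with
  | ReflectT h => inr (enum_rank_in h x)
  | ReflectF _ => inl (existT (fun _ : 'I_#|Q| => 'I_t.+1) (part x) (pos x))
  end.
have fin x : x \in U -> f x = inl (existT (fun _ : 'I_#|Q| => 'I_t.+1) (part x) (pos x)).
  by rewrite /f => xU; case: {-}_ / idP => // h; exfalso; move: h; rewrite inE xU.
have fout x : x \notin U -> exists h : x \in ~: U, f x = inr (enum_rank_in h x).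
  rewrite /f => xU; case: {-}_ / idP => [h|]; first by exists h.
  by move=> h; exfalso; apply: h; rewrite inE xU.
have partK x : x \in U -> enum_val (part x) = p x.
  by move=> xU; rewrite /part enum_rankK_in ?pQ.
have posK x : x \in U -> nat_of_ord (pos x) = index x (enum (cls x)).
  move=> xU; rewrite /pos inordK // -(pt (p x)) ?pQ // cardE index_mem mem_enum.
  by rewrite inE xU eqxx.
have finj : injective f.
  move=> x y; have [xU|/fout[hx ->]] := boolP (x \in U); have [yU|/fout[hy ->]] := boolP (y \in U).
  - rewrite !fin // => -[/(congr1 enum_val)]; rewrite !partK // => pxy.
    move=> /(congr1 (@nat_of_ord _)); rewrite !posK // => e.
    have clsE : cls x = cls y by rewrite /cls pxy.
    have xc : x \in enum (cls y) by rewrite -clsE mem_enum inE xU eqxx.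
    by rewrite -(nth_index x xc) -clsE e clsE nth_index // mem_enum inE yU eqxx.
  - by rewrite fin.
  - by rewrite fin.
  - by move=> -[/(congr1 enum_val)]; rewrite !enum_rankK_in.
exists f.
  apply: inj_card_bij finj _; rewrite card_balanced -(cardsC U) leq_add2r.
  rewrite -[#|U|]sum1_card (partition_big p (mem Q)) //= -sum_nat_const leq_sum // => q qQ.
  rewrite -(pt q qQ) -sum1_card leq_eqVlt; apply/orP; left; apply/eqP.
  by apply: eq_bigl => x; rewrite inE.
move=> x y; have [xU|xU] := boolP (x \in U); last first.
  have [h ->] := fout x xU; rewrite (negPf (notin_nonisolated y xU)).
  by case: (f y).
have [yU|yU] := boolP (y \in U); last first.
  have [h ->] := fout y yU; rewrite (adj_sym x y) (negPf (notin_nonisolated x yU)).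
  by rewrite fin.
rewrite !fin // padj //= /adj /= /multipartite_adj /=; congr (~~ _).
by rewrite -(inj_eq enum_val_inj) !partK.
Qed.

(** * The converse and the theorem *)

Lemma eigenvalue_le_sqrt_energy (R : realType) (G : sgraph) (a : R) :
  0 < a -> eigenvalue (adjacency R G) a -> a <= Num.sqrt (positive_square_energy R G).
Proof.
move=> a0; rewrite eigenvalue_root_char char_poly_eigenvalues; last first.
  by apply/matrixP => i j; rewrite !mxE adj_sym.
rewrite root_prod_XsubC => aA.
rewrite -(ger0_norm (ltW a0)) -sqrtr_sqr ler_sqrt ?energy_ge0 //.
rewrite /positive_square_energy (big_rem a aA) /= a0 lerDl.
by apply: sumr_ge0 => x _; apply: sqr_ge0.
Qed.

Lemma sum_balanced (R : realType) (r t q : nat) (F : balanced r t q -> R) :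
  \sum_w F w = \sum_(i < r) \sum_(j < t) F (inl (existT (fun _ : 'I_r => 'I_t) i j))
   + \sum_(k < q) F (inr k).
Proof.
rewrite big_sumType /=; congr (_ + _).
rewrite (sig_big_dep _ _ (fun i j => F (inl (existT (fun _ : 'I_r => 'I_t) i j)))) /=.
by apply: eq_bigr => -[i j].
Qed.

Section Balanced.
Variables (R : realType) (G : sgraph) (r t q : nat) (f : G -> balanced r t q).
Hypotheses (r2 : (2 <= r)%N) (t1 : (1 <= t)%N) (bij_f : bijective f).
Hypothesis adj_f : forall u v, adj (f u) (f v) = adj u v.

Definition in_core (w : balanced r t q) : bool := if w is inl _ then true else false.

(** Two vertices of a clique lie in different parts. *)
Lemma local_clique_number_core v : in_core (f v) -> (local_clique_number v <= r)%N.
Proof.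
move=> vc; apply/bigmax_leqP => Q /andP[vQ /cliqueP cQ].
have core u : u \in Q -> in_core (f u).
  move=> uQ; have [->//|uv] := eqVneq u v.
  by have := cQ u v uQ vQ uv; rewrite -adj_f; case: (f u) (f v) => [?|?] [?|?].
have i0 : 'I_r by apply: (Ordinal (ltnW r2)).
pose h u : 'I_r := if f u is inl p then tag p else i0.
have hinj : {in Q &, injective h}.
  move=> u w uQ wQ e; apply/eqP; apply: contraT => uw.
  have := cQ u w uQ wQ uw; move: e (core u uQ) (core w wQ); rewrite -adj_f /h.
  case: (f u) (f w) => [x|//] [y|//] e _ _ /=.
  by rewrite /adj /= /multipartite_adj e eqxx.
by rewrite -(card_in_imset hinj) (leq_trans (max_card _)) ?card_ord.
Qed.

Lemma local_clique_number_outside v : ~~ in_core (f v) -> local_clique_number v = 1%N.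
Proof.
move=> vc; apply: local_clique_number_isolated => u; rewrite -adj_f.
by move: vc; case: (f v) (f u) => [//|?] [].
Qed.

Lemma sum_clique_weights_le :
  \sum_(v : G) (1 - (local_clique_number v)%:R^-1) <= t%:R * (r%:R - 1) :> R.
Proof.
pose F (w : balanced r t q) : R := if in_core w then 1 - r%:R^-1 else 0.
have r0 : 0 < r%:R :> R by rewrite ltr0n ltnW.
apply: (@le_trans _ _ (\sum_(v : G) F (f v))).
  apply: ler_sum => v _; rewrite /F; case: ifP => vc; last first.
    by rewrite local_clique_number_outside ?vc // invr1 subrr.
  rewrite lerD2l lerN2 lef_pV2 ?posrE ?ler_nat ?local_clique_number_core //.
  rewrite ltr0n -clique_number_in_setT clique_number_in_gt0 //.
have -> : \sum_(v : G) F (f v) = \sum_(w : balanced r t q) F w.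
  by rewrite [RHS](reindex f) //; apply: onW_bij.
rewrite sum_balanced /F /= [X in _ + X]big1 // addr0.
rewrite !sumr_const !card_ord -mulr_natl -[_ *+ t]mulr_natl.
by rewrite le_eqVlt; apply/orP; left; apply/eqP; field; rewrite gt_eqF.
Qed.

(** The indicator of the vertices in the parts is an eigenvector, because the
    multipartite graph is regular. *)
Lemma core_eigenvalue : eigenvalue (adjacency R G) (t%:R * (r%:R - 1)).
Proof.
apply/eigenvalueP; exists (\row_i (in_core (f (enum_val i)))%:R).
  apply/rowP => j; rewrite !mxE; set v := enum_val j.
  pose F w : R := (in_core w)%:R * (adj w (f v))%:R.
  transitivity (\sum_(w : balanced r t q) F w).
    rewrite (reindex f) /=; last exact: onW_bij.
    rewrite (reindex (@enum_val G predT)) /=; last exact: onW_bij (enum_val_bij _).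
    by apply: eq_bigr => i _; rewrite !mxE /F adj_f.
  rewrite sum_balanced [X in _ + X]big1 ?addr0; last by move=> k _; rewrite /F mul0r.
  rewrite /F; case: (f v) => [[i0 j0]|k] /=; last first.
    rewrite [RHS]mulr0 big1 // => i _; rewrite big1 // => j' _.
    by rewrite mulr0.
  rewrite mulr1 (eq_bigr (fun i : 'I_r => t%:R * (i != i0)%:R)); last first.
    move=> i _; rewrite (eq_bigr (fun=> (i != i0)%:R)); last by move=> j' _; rewrite mul1r.
    by rewrite sumr_const card_ord mulr_natl.
  rewrite -mulr_sumr; congr (_ * _).
  rewrite (bigD1 i0) //= eqxx add0r (eq_bigr (fun=> 1)); last by move=> i ->.
  by rewrite sumr_const cardC1 card_ord -subn1 natrB // ltnW.
have i0 : 'I_r by apply: (Ordinal (ltnW r2)).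
have j0 : 'I_t by apply: (Ordinal t1).
have [f' fK f'K] := bij_f.
apply/eqP => /rowP /(_ (enum_rank (f' (inl (existT (fun _ : 'I_r => 'I_t) i0 j0))))).
by rewrite !mxE enum_rankK f'K /= => /eqP; rewrite oner_eq0.
Qed.

(** The bound is at most t(r - 1), which is an eigenvalue, hence at most the
    square root of the energy. *)
Lemma balanced_equality : Num.sqrt (positive_square_energy R G) =
  \sum_(v : G) (1 - (local_clique_number v)%:R^-1).
Proof.
apply/eqP; rewrite eq_le sqrt_energy_le /=; apply: le_trans sum_clique_weights_le _.
apply: eigenvalue_le_sqrt_energy core_eigenvalue.
by rewrite mulr_gt0 ?ltr0n // subr_gt0 ltr1n.
Qed.

End Balanced.

Lemma edgeless_equality (R : realType) (G : sgraph) : edgeless G ->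
  Num.sqrt (positive_square_energy R G) =
  \sum_(v : G) (1 - (local_clique_number v)%:R^-1).
Proof.
move=> noedge; apply/eqP; rewrite eq_le sqrt_energy_le /= big1 ?sqrtr_ge0 // => v _.
by rewrite local_clique_number_isolated ?invr1 ?subrr.
Qed.

Theorem theorem1p2 (R : realType) (G : sgraph) :
  Num.sqrt (positive_square_energy R G)
    <= \sum_(v : G) (1 - (local_clique_number v)%:R^-1)
  /\ (Num.sqrt (positive_square_energy R G)
        = \sum_(v : G) (1 - (local_clique_number v)%:R^-1)
      <-> edgeless G
          \/ exists r t q : nat, [/\ (2 <= r)%N, (1 <= t)%N
             & isomorphic G
                 (disjoint_union
                    (complete_multipartite (fun _ : 'I_r => t))
                    (isolated_vertices q))]).
Proof.
split; first exact: sqrt_energy_le.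
split=> [eq|[|[r [t [q [r2 t1 [f bij_f adj_f]]]]]]].
- have [|edge] := pselect (edgeless G); first by left.
  right; have [Q [p [t [Q1 t0 pQ padj pt]]]] := equality_structure edge eq.
  exists #|Q|, t, #|~: nonisolated G|; split=> //.
  by apply: isomorphic_balanced padj pt => //; apply: ltnW.
- exact: edgeless_equality.
- exact: balanced_equality r2 t1 bij_f adj_f.
Qed.
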